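(* Assume the standing setting in the context and that $d_1=d_2=d_3=d_4$. Let $g$ be a strictly positive function on $(0,\infty)$ with $g(t)\searrow0$ as $t\to\infty$, and set $\varphi(t)=\phi^{-1}(t g(t))$. If $$\int_1^\infty\frac{1}{t\,|\log g(t)|}\,dt<\infty\quad(\text{resp. }=\infty),$$ then for all $x_0\in M$, $$\mathbb{P}^{x_0}\big(d(X_s,x_0)\ge\varphi(s)\text{ for all sufficiently large }s\big)=1\quad(\text{resp. }=0).$$
   Context: Standing setting: $(M,d)$ is a locally compact separable metric space, $\mu$ a positive Radon measure on $M$ with full support, $(\mathcal{E},\mathcal{F})$ a regular Dirichlet form on $L^2(M;\mu)$ (strongly local part plus jump part, no killing), and $X=(\{X_t\}_{t\ge0},\{\mathbb{P}^x\}_{x\in M})$ the associated $\mu$-symmetric Hunt process. $V,\phi$ are increasing functions on $(0,\infty)$, $\phi^{-1}$ the inverse of $\phi$, and there are constants $c_i,d_i>0$ ($i=1,2,3,4$) with $c_1(R/r)^{d_1}\le V(R)/V(r)\le c_2(R/r)^{d_2}$ and $c_3(R/r)^{d_3}\le\phi(R)/\phi(r)\le c_4(R/r)^{d_4}$ for all $0<r<R<\infty$. $X$ has a symmetric heat kernel $p(t,x,y)$ ($\mathbb{P}^x(X_t\in dy)=p(t,x,y)\mu(dy)$, Chapman–Kolmogorov) defined for all $x,y\in M$, $t>0$, satisfying $$p(t,x,y)\asymp\frac{1}{V(\phi^{-1}(t))}\wedge\frac{t}{V(d(x,y))\,\phi(d(x,y))}$$ for all $x,y\in M$, $t>0$.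 Here $f\asymp g$ means $c^{-1}f\le g\le cf$ for a constant $c\ge1$ independent of the variables.
   Formalization: The integral test is read at infinity: ''finite'' means the integral from some T≥1 is finite, ''infinite'' that it diverges from every T≥1; literally, a singularity where g crosses 1 (e.g. g(t)=e^{2-t}) makes the integral from 1 infinite although the probability is 1. *)

(* Defs.v *)
From mathcomp Require Import all_boot all_order all_algebra.
From mathcomp Require Import all_classical all_reals all_analysis.
Set Implicit Arguments. Unset Strict Implicit. Unset Printing Implicit Defensive.
Import Order.TTheory GRing.Theory Num.Theory.
Local Open Scope classical_set_scope.
Local Open Scope ring_scope.

Definition is_metric (R : realType) (M : Type) (dist : M -> M -> R) : Prop :=
  [/\ (forall x y, 0 <= dist x y),
      (forall x y, dist x y = 0 <-> x = y),
      (forall x y, dist x y = dist y x) &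
      (forall x y z, dist x z <= dist x y + dist y z)].

Definition dball (R : realType) (M : Type) (dist : M -> M -> R) (x : M) (r : R)
  : set M := [set y | dist x y < r].

Definition d_open (R : realType) (M : Type) (dist : M -> M -> R) (A : set M) :=
  forall x, A x -> exists2 e : R, 0 < e & dball dist x e `<=` A.

Definition d_compact (R : realType) (M : Type) (dist : M -> M -> R) (K : set M) :=
  forall (I : Type) (G : I -> set M),
    (forall i, d_open dist (G i)) -> K `<=` \bigcup_i G i ->
    exists (n : nat) (f : 'I_n -> I), K `<=` [set x | exists k, G (f k) x].

Definition locally_compact_sep (R : realType) (M : Type) (dist : M -> M -> R) :=
  (forall x, exists K, d_compact dist K /\ exists2 r : R, 0 < r & dball dist x r `<=` K)
  /\ (exists D : set M, countable D /\
        forall x (e : R), 0 < e -> exists2 y, D y & dist x y < e).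

Definition borel_of (R : realType) (d0 : measure_display) (M : measurableType d0)
  (dist : M -> M -> R) : Prop :=
  (@measurable d0 M) = smallest (sigma_algebra setT) (d_open dist).

(* positive Radon measure with full support (on a locally compact separable
   metric space: a Borel measure finite on compact sets) *)
Definition radon_full_support (R : realType) (d0 : measure_display)
  (M : measurableType d0) (dist : M -> M -> R) (mu : {measure set M -> \bar R}) :=
  (forall K, d_compact dist K -> (mu K < +oo)%E) /\
  (forall A, d_open dist A -> A !=set0 -> (0 < mu A)%E).

Definition L2 (R : realType) (d0 : measure_display) (M : measurableType d0)
  (mu : {measure set M -> \bar R}) (f : M -> R) :=
  measurable_fun setT f /\ mu.-integrable setT (fun x => (f x ^+ 2)%:E).

Definition ip (R : realType) (d0 : measure_display) (M : measurableType d0)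
  (mu : {measure set M -> \bar R}) (f g : M -> R) : R :=
  fine (\int[mu]_x (f x * g x)%:E).

Definition E1 (R : realType) (d0 : measure_display) (M : measurableType d0)
  (mu : {measure set M -> \bar R}) (E : (M -> R) -> (M -> R) -> R) (f : M -> R) : R :=
  E f f + ip mu f f.

Definition dirichlet_form (R : realType) (d0 : measure_display) (M : measurableType d0)
  (mu : {measure set M -> \bar R}) (F : set (M -> R)) (E : (M -> R) -> (M -> R) -> R) :=
  [/\ (forall f, F f -> L2 mu f) /\
      (F (fun _ => 0) /\ (forall f g (a : R), F f -> F g -> F (fun x => f x + a * g x))) /\
      (forall f, L2 mu f -> forall e : R, 0 < e ->
         exists2 g, F g & ip mu (f \- g) (f \- g) < e),
      (* F and E respect mu-a.e. equality (elements of L^2 are classes) *)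
      (forall f g, F f -> measurable_fun setT g -> {ae mu, forall x, f x = g x} ->
         F g /\ forall h, F h -> E f h = E g h /\ E h f = E h g),
      [/\ (forall f g, F f -> F g -> E f g = E g f),
          (forall f g h (a : R), F f -> F g -> F h ->
             E (fun x => f x + a * g x) h = E f h + a * E g h) &
          (forall f, F f -> 0 <= E f f)],
      (forall u : nat -> M -> R, (forall n, F (u n)) ->
         (forall e : R, 0 < e -> exists N, forall n m, (N <= n)%N -> (N <= m)%N ->
            E1 mu E (u n \- u m) < e) ->
         exists2 f, F f & forall e : R, 0 < e -> exists N, forall n, (N <= n)%N ->
            E1 mu E (u n \- f) < e) &
      (forall f, F f -> let g := fun x => Num.min (Num.max (f x) 0) 1 in
         F g /\ E g g <= E f f)].

Definition Cc (R : realType) (M : Type) (dist : M -> M -> R) (f : M -> R) :=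
  (forall x (e : R), 0 < e -> exists2 r : R, 0 < r &
      forall y, dist x y < r -> `|f x - f y| < e) /\
  exists K, d_compact dist K /\ forall x, ~ K x -> f x = 0.

Definition regular_form (R : realType) (d0 : measure_display) (M : measurableType d0)
  (dist : M -> M -> R) (mu : {measure set M -> \bar R})
  (F : set (M -> R)) (E : (M -> R) -> (M -> R) -> R) :=
  (forall f, F f -> forall e : R, 0 < e ->
     exists g, [/\ F g, Cc dist g & E1 mu E (f \- g) < e]) /\
  (forall f, Cc dist f -> forall e : R, 0 < e ->
     exists g, [/\ F g, Cc dist g & forall x, `|f x - g x| <= e]).

(* Hunt processes (conservative: the paths live in M, no cemetery)     *)

Definition stopping_time (R : realType) (dO : measure_display) (Omega : measurableType dO)
  (Fs : R -> set (set Omega)) (tau : Omega -> \bar R) :=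
  (forall w, (0 <= tau w)%E) /\
  forall t : R, 0 <= t -> Fs t [set w | (tau w <= t%:E)%E].

Definition F_tau (R : realType) (dO : measure_display) (Omega : measurableType dO)
  (Fs : R -> set (set Omega)) (tau : Omega -> \bar R) (A : set Omega) :=
  measurable A /\ forall t : R, 0 <= t -> Fs t (A `&` [set w | (tau w <= t%:E)%E]).

Definition hunt_process (R : realType) (d0 : measure_display) (M : measurableType d0)
  (dist : M -> M -> R) (dO : measure_display) (Omega : measurableType dO)
  (P : M -> probability Omega R) (X : R -> Omega -> M) (Fs : R -> set (set Omega)) :=
  [/\
   [/\ (forall t, 0 <= t -> Fs t `<=` measurable /\ sigma_algebra setT (Fs t)),
       (forall s t, 0 <= s -> s <= t -> Fs s `<=` Fs t),
       (forall t A, 0 <= t -> (forall s, t < s -> Fs s A) -> Fs t A) &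
       (forall t B, 0 <= t -> measurable B -> Fs t (X t @^-1` B))],
   (forall A, measurable A -> measurable_fun setT (fun x => fine (P x A))) /\
   (forall x, P x (X 0 @^-1` [set x]) = 1%E),
   (forall w t, 0 <= t -> forall e : R, 0 < e -> exists2 del : R, 0 < del &
        forall s, t <= s < t + del -> dist (X s w) (X t w) < e) /\
   (forall w t, 0 < t -> exists l, forall e : R, 0 < e -> exists2 del : R, 0 < del &
        forall s, t - del < s < t -> dist (X s w) l < e),
   (forall tau, stopping_time Fs tau -> forall A, F_tau Fs tau A ->
      forall x (s : R) B, 0 <= s -> measurable B ->
      P x [set w | [/\ A w, (tau w < +oo)%E & B (X (fine (tau w) + s) w)]] =
      (\int[P x]_(w in [set w | A w /\ (tau w < +oo)%E])
          P (X (fine (tau w)) w) (X s @^-1` B))%E) &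
   (forall (taun : nat -> Omega -> \bar R) tau,
      (forall n, stopping_time Fs (taun n)) -> stopping_time Fs tau ->
      (forall n w, (taun n w <= taun n.+1 w)%E) ->
      (forall w, (fun n => taun n w) @ \oo --> tau w) ->
      forall x, (P x).-negligible
        [set w | (tau w < +oo)%E /\
           ~ (forall e : R, 0 < e -> exists N, forall n, (N <= n)%N ->
                dist (X (fine (taun n w)) w) (X (fine (tau w)) w) < e)])].

Definition resolvent (R : realType) (d0 : measure_display) (M : measurableType d0)
  (dO : measure_display) (Omega : measurableType dO)
  (P : M -> probability Omega R) (X : R -> Omega -> M) (alpha : R) (f : M -> R) : M -> R :=
  fun x => fine (\int[lebesgue_measure]_(t in `[0, +oo[)
                  (expR (- (alpha * t)) * fine (\int[P x]_w (f (X t w))%:E))%:E).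

(* X is associated with (E,F): for alpha > 0 and bounded Borel f in L^2,
   R_alpha f is a mu-version of the L^2 resolvent G_alpha f of (E,F), i.e.
   R_alpha f in F and E_alpha(R_alpha f, v) = (f, v) for all v in F. *)
Definition associated (R : realType) (d0 : measure_display) (M : measurableType d0)
  (mu : {measure set M -> \bar R}) (F : set (M -> R)) (E : (M -> R) -> (M -> R) -> R)
  (dO : measure_display) (Omega : measurableType dO)
  (P : M -> probability Omega R) (X : R -> Omega -> M) :=
  forall (alpha : R) (f : M -> R), 0 < alpha -> L2 mu f ->
    (exists C : R, forall x, `|f x| <= C) ->
    let u := resolvent P X alpha f in
    F u /\ forall v, F v -> E u v + alpha * ip mu u v = ip mu f v.

Definition heat_kernel_of (R : realType) (d0 : measure_display) (M : measurableType d0)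
  (mu : {measure set M -> \bar R}) (dO : measure_display) (Omega : measurableType dO)
  (P : M -> probability Omega R) (X : R -> Omega -> M) (p : R -> M -> M -> R) :=
  [/\ (forall t x, 0 < t -> measurable_fun setT (p t x)),
      (forall t x B, 0 < t -> measurable B ->
         P x (X t @^-1` B) = (\int[mu]_(y in B) (p t x y)%:E)%E),
      (forall t x y, 0 < t -> p t x y = p t y x) &
      (forall s t x y, 0 < s -> 0 < t ->
         (p (s + t) x y)%:E = (\int[mu]_z (p s x z * p t z y)%:E)%E)].

(* the right-hand side of the two-sided heat kernel estimate;
   for x = y the second term is +oo, so only the first term remains *)
Definition hk_profile (R : realType) (M : Type) (dist : M -> M -> R)
  (V phi phiinv : R -> R) (t : R) (x y : M) : R :=
  if dist x y == 0 then (V (phiinv t))^-1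
  else Num.min (V (phiinv t))^-1 (t / (V (dist x y) * phi (dist x y))).

(* positive (non-strictly) increasing function on (0,oo) with the two-sided
   scaling condition; strictness of phi follows from the inverse hypotheses *)
Definition scaling (R : realType) (V : R -> R) (c1 c2 d1 d2 : R) :=
  [/\ (forall r, 0 < r -> 0 < V r),
      (forall r s, 0 < r -> r < s -> V r <= V s) &
      (forall r s, 0 < r -> r < s ->
         c1 * powR (s / r) d1 <= V s / V r /\ V s / V r <= c2 * powR (s / r) d2)].

Definition tail_integral (R : realType) (g : R -> R) (T : R) : \bar R :=
  (\int[lebesgue_measure]_(t in `[T, +oo[) ((t * `|ln (g t)|)^-1)%:E)%E.

(* Main.v *)
(* Write rho = dist ^ D with D the common value of the d_i.  Then V and phi are both
   comparable to r ^ D, so p(t,x,y) is comparable to min(1/t, t/rho^2) and balls of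
   rho-radius q have volume comparable to q: the process is critical (as planar Brownian
   motion), and P(rho(X_(t+u), x0) < q | F_t) is comparable to q / u once q and
   rho(X_t, x0) are small compared with u.  Summing this over a fine time grid and
   decomposing at the first visit, the probability of visiting {rho < q} during
   [t, 4t] is at most of order 1 / log (t / q).  With windows [4^n, 4^(n+1)) and
   q of order 4^n g(4^n) this is 1 / |log g(4^n)|, so a finite integral gives escape by
   Borel-Cantelli.  If the integral diverges, weight the visits in the n-th window so
   that the expected weighted number of visits is of order a_n = 1 / |log g(4^(n+1))|.
   The expected weight still to come after any time is at most C1 + C2 sum a_n,
   where C1 accounts for the current and the next window only; hence, by the same
   first-visit decomposition, a visit occurs with probability bounded below, given any
   past, and iterating this along the filtration gives recurrence. *)
Require Import Defs.
From mathcomp Require Import all_boot all_order all_algebra.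
From mathcomp Require Import all_classical all_reals all_analysis.
From mathcomp Require Import measurable_realfun zify ring lra.
Set Implicit Arguments. Unset Strict Implicit. Unset Printing Implicit Defensive.
Import Order.TTheory GRing.Theory Num.Theory.
Local Open Scope classical_set_scope.
Local Open Scope ring_scope.

(** * Scaling functions and the heat kernel profile *)

(** Comparing [r] with 1 in the scaling condition, whose two exponents agree here, pins [V r] to
    [V 1 * r ^ D] up to a constant factor. *)
Lemma scaling_powR (R : realType) (V : R -> R) (c1 c2 D : R) :
  0 < c1 -> 0 < c2 -> scaling V c1 c2 D D ->
  exists2 k, 0 < k & forall r : R, 0 < r -> k^-1 * r `^ D <= V r <= k * r `^ D.
Proof.
move=> c10 c20 [V0 _ Vs].
have V10 := V0 _ ltr01.
(* [m] dominates 1, [c2] and [c1^-1], so it serves for [r = 1], [r > 1] and [r < 1] alike; the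
   factor [V 1 + (V 1)^-1] below absorbs [V 1] on both sides. *)
pose m := 1 + c2 + c1^-1.
have c1i : 0 < c1^-1 by rewrite invr_gt0.
have m1 : 1 <= m by rewrite /m; lra.
have m0 : 0 < m by lra.
have V1i : 0 < (V 1)^-1 by rewrite invr_gt0.
have k0 : 0 < m * (V 1 + (V 1)^-1) by rewrite mulr_gt0 // addr_gt0.
exists (m * (V 1 + (V 1)^-1)) => // r r0.
have rD : 0 < r `^ D by rewrite powR_gt0.
suff /andP[lo hi] : V 1 / m * r `^ D <= V r <= V 1 * m * r `^ D.
  apply/andP; split.
    apply: (le_trans _ lo); rewrite ler_pM2r // invfM mulrC ler_pM2r ?invr_gt0//.
    rewrite -[leRHS]invrK lef_pV2 ?posrE ?addr_gt0 ?invr_gt0 //; lra.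
  by apply: (le_trans hi); rewrite ler_pM2r // [leRHS]mulrC ler_pM2r //; lra.
have c1m : c1^-1 <= m by rewrite /m; lra.
have c2m : c2 <= m by rewrite /m; lra.
have m1c : m^-1 <= c1 by rewrite -[leRHS]invrK lef_pV2 ?posrE ?invr_gt0.
have m1i : m^-1 <= 1 by rewrite invf_le1.
have [r1|r1|->] := ltgtP r 1; last first.
- by rewrite powR1 !mulr1; apply/andP; split; [rewrite ler_pdivrMr// ler_peMr// ltW|rewrite ler_peMr// ltW].
- have [] := Vs _ _ ltr01 r1; rewrite divr1 ler_pdivlMr // ler_pdivrMr // => h1 h2.
  apply/andP; split.
    apply: (le_trans _ h1).
    have -> : V 1 / m * r `^ D = m^-1 * (V 1 * r `^ D) by ring.
    have -> : c1 * r `^ D * V 1 = c1 * (V 1 * r `^ D) by ring.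
    by rewrite ler_pM2r ?mulr_gt0.
  apply: (le_trans h2).
  have -> : V 1 * m * r `^ D = m * (V 1 * r `^ D) by ring.
  have -> : c2 * r `^ D * V 1 = c2 * (V 1 * r `^ D) by ring.
  by rewrite ler_pM2r ?mulr_gt0.
- have [] := Vs _ _ r0 r1; have Vr0 := V0 _ r0.
  rewrite ler_pdivlMr // ler_pdivrMr // div1r => h1 h2.
  have e : (r^-1) `^ D = (r `^ D)^-1.
    apply: (mulIf (lt0r_neq0 rD)); rewrite mulVf ?gt_eqF// -powRM ?invr_ge0 ?ltW//.
    by rewrite mulVf ?gt_eqF// powR1.
  move: h1 h2; rewrite e => h1 h2.
  have {}h1 : c1 * V r <= V 1 * r `^ D.
    by rewrite -ler_pdivrMr// mulrAC.
  have {}h2 : V 1 * r `^ D <= c2 * V r.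
    by rewrite -ler_pdivlMr// mulrAC.
  apply/andP; split.
    rewrite mulrAC ler_pdivrMr//; apply: (le_trans h2).
    by rewrite [leRHS]mulrC ler_pM2r.
  rewrite -(ler_pM2l c10); apply: (le_trans h1).
  have -> : c1 * (V 1 * m * r `^ D) = c1 * m * (V 1 * r `^ D) by ring.
  have cm : 1 <= c1 * m by rewrite -ler_pdivrMl // mulr1.
  by rewrite ler_peMl // ltW // mulr_gt0.
Qed.

(** * Heat kernel profile in terms of [dist ^ D] *)

Section heat_kernel_bounds.
Variables (R : realType) (M : Type) (dist : M -> M -> R).
Variables (V phi phiinv : R -> R) (D k l : R).
Hypothesis dist_ge0 : forall x y, 0 <= dist x y.
Hypothesis D0 : 0 < D.
Hypothesis k0 : 0 < k.
Hypothesis l0 : 0 < l.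
Hypothesis hV : forall r : R, 0 < r -> k^-1 * r `^ D <= V r <= k * r `^ D.
Hypothesis hphi : forall r : R, 0 < r -> l^-1 * r `^ D <= phi r <= l * r `^ D.
Hypothesis hinv : forall t : R, 0 < t -> 0 < phiinv t /\ phi (phiinv t) = t.

Lemma phiinv_powR (t : R) : 0 < t -> l^-1 * t <= phiinv t `^ D <= l * t.
Proof.
move=> /hinv[r0 e]; have := hphi r0; rewrite e => /andP[h1 h2].
by rewrite ler_pdivrMl // h2 -ler_pdivrMl.
Qed.

(** Together with the converse below, this trades the curve [phiinv (t * g t)] for rho-radii of
    order [t * g t], at the price of a factor [l]. *)
Lemma lt_phiinv_powR (t d : R) : 0 < t -> 0 <= d -> d < phiinv t -> d `^ D < l * t.
Proof.
move=> t0 d0 dt; have /andP[_] := phiinv_powR t0; apply: lt_le_trans.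
by apply: gt0_ltr_powR; rewrite ?nnegrE // ltW // (le_lt_trans d0).
Qed.

Lemma powR_lt_phiinv (t d : R) : 0 < t -> 0 <= d -> d `^ D < l^-1 * t -> d < phiinv t.
Proof.
move=> t0 d0 dt; have /andP[h _] := phiinv_powR t0.
rewrite ltNge; apply/negP => dp.
have := lt_le_trans dt h; rewrite ltNge => /negP; apply.
apply: ge0_ler_powR; rewrite ?nnegrE // ltW //; exact: (hinv t0).1.
Qed.

Lemma V_phiinv (t : R) : 0 < t -> (k * l)^-1 * t <= V (phiinv t) <= k * l * t.
Proof.
move=> t0; have [r0 _] := hinv t0.
have /andP[h1 h2] := phiinv_powR t0; have /andP[v1 v2] := hV r0.
apply/andP; split.
  by apply: (le_trans _ v1); rewrite invfM -mulrA ler_pM2l ?invr_gt0.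
by apply: (le_trans v2); rewrite -mulrA ler_pM2l.
Qed.

Let prof := hk_profile dist V phi phiinv.

Lemma hk_profile_le_inv (t : R) (x y : M) : 0 < t -> prof t x y <= k * l / t.
Proof.
move=> t0; have /andP[h1 h2] := V_phiinv t0.
have : (V (phiinv t))^-1 <= k * l / t.
  rewrite -[k * l]invrK -invfM lef_pV2 // posrE ?mulr_gt0 ?invr_gt0 ?mulr_gt0 //.
  by apply: lt_le_trans h1; rewrite mulr_gt0 ?invr_gt0 ?mulr_gt0.
by rewrite /prof /hk_profile; case: ifP => // _; rewrite ge_min => ->.
Qed.

Lemma V_phi (r : R) : 0 < r ->
  (k * l)^-1 * (r `^ D) ^+ 2 <= V r * phi r <= k * l * (r `^ D) ^+ 2.
Proof.
move=> r0; have /andP[h1 h2] := hV r0; have /andP[p1 p2] := hphi r0.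
have rD : 0 < r `^ D by rewrite powR_gt0.
have -> : (k * l)^-1 * (r `^ D) ^+ 2 = (k^-1 * r `^ D) * (l^-1 * r `^ D).
  by rewrite invfM; ring.
have -> : k * l * (r `^ D) ^+ 2 = (k * r `^ D) * (l * r `^ D) by ring.
have ki : 0 < k^-1 * r `^ D by rewrite mulr_gt0 ?invr_gt0.
have li : 0 < l^-1 * r `^ D by rewrite mulr_gt0 ?invr_gt0.
apply/andP; split; first by apply: ler_pM => //; exact: ltW.
by apply: ler_pM => //; [exact: le_trans (ltW ki) h1|exact: le_trans (ltW li) p1].
Qed.

Lemma hk_profile_le_off (t : R) (x y : M) : 0 < t -> 0 < dist x y ->
  prof t x y <= k * l * t / (dist x y `^ D) ^+ 2.
Proof.
move=> t0 r0; rewrite /prof /hk_profile gt_eqF // ge_min; apply/orP; right.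
have /andP[h _] := V_phi r0.
have rD : 0 < (dist x y `^ D) ^+ 2 by rewrite exprn_gt0 // powR_gt0.
have kl : 0 < (k * l)^-1 * (dist x y `^ D) ^+ 2.
  by apply: mulr_gt0 => //; rewrite invr_gt0 mulr_gt0.
have -> : k * l * t / (dist x y `^ D) ^+ 2 = t / ((k * l)^-1 * (dist x y `^ D) ^+ 2).
  by rewrite [in RHS]invfM invrK; ring.
by rewrite ler_pM2l // lef_pV2 ?posrE // (lt_le_trans kl).
Qed.

(** When rho is at most [t], the off-diagonal term, of order [t / rho^2], is itself at least of
    order [1 / t], so the minimum is. *)
Lemma hk_profile_ge (t : R) (x y : M) : 0 < t -> dist x y `^ D <= t -> (k * l)^-1 / t <= prof t x y.
Proof.
move=> t0 rt; have /andP[h1 h2] := V_phiinv t0.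
have kl : 0 < k * l by rewrite mulr_gt0.
have hV1 : (k * l)^-1 / t <= (V (phiinv t))^-1.
  rewrite -invfM lef_pV2 // posrE ?mulr_gt0//.
  by apply: lt_le_trans h1; rewrite mulr_gt0 ?invr_gt0.
rewrite /prof /hk_profile; case: ifP => // /negbT d0; rewrite le_min hV1 /=.
have r0 : 0 < dist x y by rewrite lt_neqAle eq_sym d0 dist_ge0.
have rD : 0 < dist x y `^ D by rewrite powR_gt0.
have /andP[g1 g2] := V_phi r0.
have g0 : 0 < V (dist x y) * phi (dist x y).
  by apply: lt_le_trans g1; rewrite mulr_gt0 ?invr_gt0 // exprn_gt0.
have -> : t / (V (dist x y) * phi (dist x y)) = (t^-1 * (V (dist x y) * phi (dist x y)))^-1.
  by rewrite [in RHS]invfM invrK.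
rewrite -invfM lef_pV2 ?posrE; first last.
- by apply: mulr_gt0 => //; rewrite invr_gt0.
- exact: mulr_gt0.
rewrite ler_pdivrMl // [leRHS]mulrC; apply: (le_trans g2).
by rewrite -(mulrA (k * l)) ler_pM2l // -expr2 ler_pXn2r ?nnegrE ?(ltW rD) ?(ltW t0).
Qed.

Lemma hk_profile_ge0 (t : R) (x y : M) : 0 < t -> 0 <= prof t x y.
Proof.
move=> t0; have kl : 0 < (k * l)^-1 by rewrite invr_gt0 mulr_gt0.
have /andP[h _] := V_phiinv t0.
have Vt : 0 <= (V (phiinv t))^-1 by rewrite invr_ge0 (le_trans _ h) // ltW // mulr_gt0.
rewrite /prof /hk_profile; case: ifP => // /negbT d0; rewrite le_min Vt /=.
have r0 : 0 < dist x y by rewrite lt_neqAle eq_sym d0 dist_ge0.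
have /andP[g _] := V_phi r0; rewrite divr_ge0 // ?ltW // (lt_le_trans _ g) //.
by rewrite mulr_gt0 // exprn_gt0 // powR_gt0.
Qed.

End heat_kernel_bounds.

(** * Decomposition at the first visit *)

Section first_entrance.
Variables (R : realType) (d : measure_display) (Omega : measurableType d).
Variables (P : probability Omega R).

Local Notation Q A := (fine (P A)).

Lemma fine_prob_ge0 (A : set Omega) : 0 <= Q A.
Proof. exact: fine_ge0. Qed.

Lemma fine_probU (A B : set Omega) : measurable A -> measurable B -> A `&` B = set0 ->
  Q (A `|` B) = Q A + Q B.
Proof.
move=> mA mB AB; rewrite measureU // fineD //; exact: fin_num_measure.
Qed.

Lemma le_fine_prob (A B : set Omega) : measurable A -> measurable B -> A `<=` B -> Q A <= Q B.
Proof.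
move=> mA mB AB; rewrite fine_le ?fin_num_measure //; apply: le_measure => //; exact/mem_set.
Qed.

Lemma fine_prob_split (A B : set Omega) : measurable A -> measurable B ->
  Q A = Q (A `&` B) + Q (A `\` B).
Proof.
move=> mA mB; rewrite -fine_probU //; [by rewrite setUIDK|exact: measurableI|exact: measurableD|].
by rewrite setDE setIACA setICr setI0.
Qed.

Lemma fine_prob_splitI (A B C : set Omega) : measurable A -> measurable B -> measurable C ->
  Q (A `&` C) = Q (A `&` B `&` C) + Q ((A `\` B) `&` C).
Proof.
move=> mA mB mC; rewrite (@fine_prob_split (A `&` C) B) //; last exact: measurableI.
by congr (Q _ + Q _); [rewrite setIAC|rewrite !setDE setIAC].
Qed.

Variables (Fs : nat -> set (set Omega)) (H : nat -> set Omega) (w : nat -> R).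
Hypothesis Fs_meas : forall i A, Fs i A -> measurable A.
Hypothesis FsI : forall i A B, Fs i A -> Fs i B -> Fs i (A `&` B).
Hypothesis FsD : forall i A B, Fs i A -> Fs i B -> Fs i (A `\` B).
Hypothesis FsS : forall i A, Fs i A -> Fs i.+1 A.
Hypothesis FsH : forall i, Fs i (H i).

Definition hit (i j : nat) : set Omega := \bigcup_(k in [set k | (i <= k < j)%N]) H k.

Lemma hit_rec i j : (i < j)%N -> hit i j = H i `|` hit i.+1 j.
Proof.
move=> ij; apply/seteqP; split=> [x [k /= /andP[ik kj] Hk]|x [Hi|[k /= /andP[ik kj] Hk]]].
- move: ik; rewrite leq_eqVlt => /orP[/eqP ->|ik]; first by left.
  by right; exists k => //=; rewrite ik.
- by exists i => //=; rewrite leqnn.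
- by exists k => //=; rewrite (ltnW ik).
Qed.

Lemma hit0 i j : (j <= i)%N -> hit i j = set0.
Proof.
by move=> ji; apply/seteqP; split=> // x [k /= /andP[ik /(leq_ltn_trans ik)]]; rewrite ltnNge ji.
Qed.

Lemma measurable_hit i j : measurable (hit i j).
Proof. by apply: bigcup_measurable => k _; exact: Fs_meas (FsH k). Qed.

(* Decompose at the first index [j] with [H j]: before it the sum vanishes,
   and after it the hypothesis applies to the event of a first visit at [j]. *)
Lemma first_entrance_le (i n : nat) (theta : R) :
  (forall j A, (i <= j < n)%N -> Fs j A -> A `<=` H j ->
     \sum_(j <= l < n) w l * Q (A `&` H l) <= theta * Q A) ->
  forall A, (i <= n)%N -> Fs i A ->
     \sum_(i <= l < n) w l * Q (A `&` H l) <= theta * Q (A `&` hit i n).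
Proof.
move=> hyp A i_n; rewrite -(subKn i_n).
move: {-2}(n - i)%N (leqnn (n - i)) => k; elim: k A => [|k IH] A kn FA.
  by rewrite subn0 big_geq // hit0 // setI0 measure0 mulr0.
set j := (n - k.+1)%N; have jn : (i <= j < n)%N by rewrite /j; lia.
have /andP[ij jn'] := jn.
have jS : (n - k = j.+1)%N by rewrite /j; lia.
have mA := Fs_meas FA; have mH m := Fs_meas (FsH m).
have FAH := FsI FA (FsH j); have FAD := FsD FA (FsH j).
have E l : Q (A `&` H l) = Q (A `&` H j `&` H l) + Q ((A `\` H j) `&` H l).
  exact: fine_prob_splitI.
under eq_bigr do rewrite E mulrDr.
rewrite big_split /= hit_rec //.
have -> : Q (A `&` (H j `|` hit j.+1 n)) = Q (A `&` H j) + Q ((A `\` H j) `&` hit j.+1 n).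
  rewrite (@fine_prob_split (A `&` (H j `|` hit j.+1 n)) (H j)) //; last first.
    by apply: measurableI => //; apply: measurableU => //; exact: measurable_hit.
  congr (Q _ + Q _); apply/seteqP; split => x /=.
  - by move=> [[? ?] ?].
  - by move=> [? ?]; split => //; split => //; left.
  - by move=> [[? [?|?]] ?].
  - by move=> [[? ?] ?]; split => //; split => //; right.
rewrite mulrDr lerD //.
  by apply: hyp => // x [].
(* On [A] without [H j] the term of index [j] vanishes, so the sum starts at [j.+1], where this
   event is still known. *)
rewrite big_ltn // [X in Q X](_ : _ = set0) ?measure0 ?mulr0 ?add0r; last first.
  by apply/seteqP; split => // x [[]].
by rewrite -jS; apply: IH; [exact: ltnW|rewrite jS; exact: FsS].
Qed.

(** The same decomposition, but visits are sought before [m] while the sum runs to a later horizon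
    [n]: a visit just before [m] still leaves time for further visits. The terms beyond [m] are
    discarded by positivity. *)
Lemma first_entrance_ge (i m n : nat) (theta : R) : (m <= n)%N ->
  (forall l, 0 <= w l) ->
  (forall j A, (i <= j < m)%N -> Fs j A -> A `<=` H j ->
     theta * Q A <= \sum_(j <= l < n) w l * Q (A `&` H l)) ->
  forall A, (i <= m)%N -> Fs i A ->
     theta * Q (A `&` hit i m) <= \sum_(i <= l < n) w l * Q (A `&` H l).
Proof.
move=> mn w0 hyp A i_m; rewrite -(subKn i_m).
move: {-2}(m - i)%N (leqnn (m - i)) => k; elim: k A => [|k IH] A km FA.
  rewrite subn0 hit0 // setI0 measure0 mulr0; apply: sumr_ge0 => l _.
  by rewrite mulr_ge0 // fine_prob_ge0.
set j := (m - k.+1)%N; have jm : (i <= j < m)%N by rewrite /j; lia.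
have jn : (j < n)%N by lia.
have /andP[ij jm'] := jm.
have jS : (m - k = j.+1)%N by rewrite /j; lia.
have mA := Fs_meas FA; have mH p := Fs_meas (FsH p).
have FAH := FsI FA (FsH j); have FAD := FsD FA (FsH j).
have E l : Q (A `&` H l) = Q (A `&` H j `&` H l) + Q ((A `\` H j) `&` H l).
  exact: fine_prob_splitI.
under eq_bigr do rewrite E mulrDr.
rewrite big_split /= hit_rec //.
have -> : Q (A `&` (H j `|` hit j.+1 m)) = Q (A `&` H j) + Q ((A `\` H j) `&` hit j.+1 m).
  rewrite (@fine_prob_split (A `&` (H j `|` hit j.+1 m)) (H j)) //; last first.
    by apply: measurableI => //; apply: measurableU => //; exact: measurable_hit.
  congr (Q _ + Q _); apply/seteqP; split => x /=.
  - by move=> [[? ?] ?].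
  - by move=> [? ?]; split => //; split => //; left.
  - by move=> [[? [?|?]] ?].
  - by move=> [[? ?] ?]; split => //; split => //; right.
rewrite mulrDr lerD //.
  by apply: hyp => // x [].
rewrite [leRHS]big_ltn // [X in w j * Q X](_ : _ = set0) ?measure0 ?mulr0 ?add0r; last first.
  by apply/seteqP; split => // x [[]].
by rewrite -jS; apply: IH; [exact: ltnW|rewrite jS; exact: FsS].
Qed.

End first_entrance.

(** * Volume of balls and Markov estimates *)

Lemma sigma_algebra_setU (T : Type) (G : set (set T)) (A B : set T) :
  sigma_algebra setT G -> G A -> G B -> G (A `|` B).
Proof.
move=> [G0 _ GU] GA GB; rewrite -bigcup2E; apply: GU => i.
by rewrite /bigcup2; case: ifP => // _; case: ifP.
Qed.

Lemma sigma_algebra_setI (T : Type) (G : set (set T)) (A B : set T) :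
  sigma_algebra setT G -> G A -> G B -> G (A `&` B).
Proof.
move=> sG GA GB; have [_ GC _] := sG.
have GC' C : G C -> G (~` C) by rewrite -setTD; exact: GC.
rewrite -(setCK (A `&` B)) setCI; apply: (GC').
by apply: sigma_algebra_setU => //; exact: GC'.
Qed.

Lemma sigma_algebra_setD (T : Type) (G : set (set T)) (A B : set T) :
  sigma_algebra setT G -> G A -> G B -> G (A `\` B).
Proof.
move=> sG GA GB; have [_ GC _] := sG; rewrite setDE.
by apply: sigma_algebra_setI => //; rewrite -setTD; exact: GC.
Qed.

(** Balls for rho, which need not be a metric when [D > 1]. The strict inequality makes them open,
    so that right-continuous paths stay in them for a while. *)
Definition rball (R : realType) (M : Type) (dist : M -> M -> R) (D : R) (x : M) (q : R) :
  set M := [set y | dist x y `^ D < q].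

Section rball_theory.
Variables (R : realType) (d0 : measure_display) (M : measurableType d0).
Variables (dist : M -> M -> R) (D : R).
Hypothesis hmetric : is_metric dist.
Hypothesis hborel : borel_of dist.
Hypothesis D0 : 0 < D.

Let dist_ge0 x y : 0 <= dist x y. Proof. by case: hmetric. Qed.
Let dist_sym x y : dist x y = dist y x. Proof. by case: hmetric. Qed.
Let dist_tri x y z : dist x z <= dist x y + dist y z. Proof. by case: hmetric. Qed.

Lemma d_open_dball (x : M) (r : R) : d_open dist (dball dist x r).
Proof.
move=> y yr; exists (r - dist x y); first by rewrite subr_gt0.
move=> z; rewrite /dball /= ltrBrDl; exact: le_lt_trans.
Qed.

Lemma rball_dball (x : M) (q : R) : 0 < q -> rball dist D x q = dball dist x (q `^ D^-1).
Proof.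
move=> q0; have qD : (q `^ D^-1) `^ D = q by rewrite -powRrM mulVf ?gt_eqF// powRr1 // ltW.
apply/seteqP; split => y /=; rewrite /rball /dball /= => h; last first.
  by rewrite -qD; apply: gt0_ltr_powR => //; rewrite nnegrE // powR_ge0.
rewrite ltNge; apply/negP => h'; move: h; rewrite ltNge => /negP; apply.
by rewrite -[leLHS]qD; apply: ge0_ler_powR => //; rewrite ?nnegrE ?powR_ge0 // ltW.
Qed.

Lemma measurable_rball (x : M) (q : R) : 0 < q -> measurable (rball dist D x q).
Proof.
move=> q0; rewrite rball_dball //; move: hborel; rewrite /borel_of => ->.
by apply: (@sub_smallest _ _ _ (d_open dist)) => //; exact: d_open_dball.
Qed.

(** The substitute for the triangle inequality of rho; the factor [2 ^ D] becomes the constant [K]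
    of the abstract process. *)
Lemma dist_powR_max (x y z : M) (q : R) :
  dist x y `^ D <= q -> dist x z `^ D <= q -> dist y z `^ D <= 2 `^ D * q.
Proof.
move=> xy xz.
have m0 : 0 <= Num.max (dist x y) (dist x z) by rewrite le_max dist_ge0.
have : dist y z <= 2 * Num.max (dist x y) (dist x z).
  apply: (le_trans (dist_tri y x z)); rewrite dist_sym mulrDl !mul1r.
  by apply: lerD; rewrite le_max lexx ?orbT.
move=> h; apply: (@le_trans _ _ ((2 * Num.max (dist x y) (dist x z)) `^ D)).
  by apply: ge0_ler_powR; rewrite ?nnegrE ?mulr_ge0 // ltW.
rewrite powRM // ler_pM2l ?powR_gt0 //.
by have [] := leP (dist x y) (dist x z).
Qed.

Variables (mu : {measure set M -> \bar R}).
Variables (dO : measure_display) (Omega : measurableType dO).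
Variables (P : M -> probability Omega R) (X : R -> Omega -> M) (Fs : R -> set (set Omega)).
Hypothesis hX : hunt_process dist P X Fs.
Variables (p : R -> M -> M -> R) (a b : R).
Hypothesis hp : heat_kernel_of mu P X p.
Hypothesis a0 : 0 < a.
Hypothesis b0 : 0 < b.
Hypothesis p_ge0 : forall (t : R) x y, 0 < t -> 0 <= p t x y.
Hypothesis p_le : forall (t : R) x y, 0 < t -> p t x y <= b / t.
Hypothesis p_le_off : forall (t : R) x y, 0 < t -> 0 < dist x y ->
  p t x y <= b * t / (dist x y `^ D) ^+ 2.
Hypothesis p_ge : forall (t : R) x y, 0 < t -> dist x y `^ D <= t -> a / t <= p t x y.

Local Notation G := (rball dist D).

Let Fs_meas (t : R) A : 0 <= t -> Fs t A -> measurable A.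
Proof. by case: hX => -[h _ _ _] _ _ _ _ t0; apply: (h t t0).1. Qed.

Let X_meas (t : R) : 0 <= t -> measurable_fun setT (X t).
Proof.
move=> t0 _ B mB; rewrite setTI; apply: (@Fs_meas t) => //.
by case: hX => -[_ _ _ h] _ _ _ _; exact: h.
Qed.

Let PE (t : R) x B : 0 < t -> measurable B -> P x (X t @^-1` B) = (\int[mu]_(y in B) (p t x y)%:E)%E.
Proof. by case: hp => _ h _ _; exact: h. Qed.

Let p_meas (t : R) (x : M) (B : set M) : 0 < t -> measurable_fun B (fun y : M => (p t x y)%:E).
Proof.
by move=> t0; apply/measurable_EFinP; apply: measurable_funTS; case: hp => h _ _ _; exact: h.
Qed.

(** The strong Markov property at the constant stopping time [t], for which the event that it is at
    most [u] is either everything or empty. *)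
Lemma markov (t s : R) (A : set Omega) (x : M) (B : set M) : 0 <= t -> 0 <= s ->
  Fs t A -> measurable B ->
  (P x (A `&` X (t + s) @^-1` B) = \int[P x]_(w in A) P (X t w) (X s @^-1` B))%E.
Proof.
move=> t0 s0 FA mB; case: hX => -[Fsub Fmono _ _] _ _ sM _.
have tau_st : stopping_time Fs (fun _ : Omega => t%:E).
  split=> [w|u u0]; first by rewrite lee_fin.
  have [F0 FC _] := (Fsub u u0).2.
  have [tu|ut] := leP t u.
    rewrite (_ : [set _ | _] = setT); last by apply/seteqP; split => // w _ /=; rewrite lee_fin.
    by rewrite -(setD0 setT); apply: FC.
  rewrite (_ : [set _ | _] = set0) //; apply/seteqP; split => // w /=.
  by rewrite lee_fin leNgt ut.
have FtA : F_tau Fs (fun _ : Omega => t%:E) A.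
  split=> [|u u0]; first exact: Fs_meas FA.
  have [F0 _ _] := (Fsub u u0).2.
  have [tu|ut] := leP t u.
    rewrite (_ : [set _ | _] = setT); last by apply/seteqP; split => // w _ /=; rewrite lee_fin.
    by rewrite setIT; exact: (Fmono t u).
  rewrite (_ : [set _ | _] = set0) ?setI0 //; apply/seteqP; split => // w /=.
  by rewrite lee_fin leNgt ut.
have := sM _ tau_st _ FtA x s B s0 mB.
rewrite (_ : [set w | [/\ A w, _ & _]] = A `&` X (t + s) @^-1` B); last first.
  by apply/seteqP; split => w /=; [case|case=> ? ?; split => //; exact: ltry].
move=> ->; congr (integral _ _ _).
by apply/seteqP; split => w /=; [case|move=> ?; split => //; exact: ltry].
Qed.

Let P_meas (t s : R) (A : set Omega) (B : set M) : 0 <= t -> 0 <= s -> measurable B ->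
  measurable_fun A (fun w => P (X t w) (X s @^-1` B)).
Proof.
move=> t0 s0 mB; have mXB : measurable (X s @^-1` B) by rewrite -[X in measurable X]setTI; exact: X_meas.
rewrite (_ : (fun w => _) = EFin \o ((fun y => fine (P y (X s @^-1` B))) \o X t)); last first.
  by apply/funext => w /=; rewrite fineK // fin_num_measure.
apply/measurable_EFinP; apply: measurable_funTS; apply: measurableT_comp; last exact: X_meas.
by case: hX => _ [h _] _ _ _; exact: h.
Qed.

(** At time [q] the kernel is at least [a / q] on the ball, and its integral there is a
    probability. *)
Lemma mu_rball_le (x : M) (q : R) : 0 < q -> (mu (G x q) <= (a^-1 * q)%:E)%E.
Proof.
move=> q0; have mG := measurable_rball x q0.
have : ((a / q)%:E * mu (G x q) <= 1)%E.
  rewrite -integral_cst //.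
  apply: (@le_trans _ _ (P x (X q @^-1` (G x q)))); last first.
    by apply: probability_le1; rewrite -[X in measurable X]setTI; apply: X_meas => //; exact: ltW.
  rewrite PE //; apply: ge0_le_integral => //.
  - by move=> y _ /=; rewrite lee_fin divr_ge0 // ltW.
  - exact: p_meas.
  - by move=> y /= /ltW yq; rewrite lee_fin; exact: p_ge.
have aq : 0 < a / q by rewrite divr_gt0.
rewrite -lee_pdivlMl // mule1 => /le_trans; apply.
by rewrite lee_fin invfM invrK.
Qed.

Let lam := 1 + 4 * b / a.
(** The constant obtained by solving [a / (4 * t) <= (b / t) ^ 2 * mu (G x q)] for the volume at
    [t = q / lam]. *)
Definition volume_const := a / (4 * b ^+ 2 * (1 + 4 * b / a)).

Lemma volume_const_gt0 : 0 < volume_const.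
Proof.
rewrite divr_gt0 // mulr_gt0 // ?mulr_gt0 ?exprn_gt0 //.
by rewrite addr_gt0 // divr_gt0 // mulr_gt0.
Qed.

(* By Chapman-Kolmogorov [p (2 t) x x] is the integral of [p t x z ^ 2], and the
   part of this integral outside a ball of [rho]-radius [lam * t] is at most half of it. *)
Lemma mu_rball_ge (x : M) (q : R) : 0 < q -> ((volume_const * q)%:E <= mu (G x q))%E.
Proof.
move=> q0; have mG := measurable_rball x q0.
have lam1 : 1 <= lam by rewrite /lam lerDl divr_ge0 ?mulr_ge0 // ltW.
have lam0 : 0 < lam by exact: lt_le_trans lam1.
pose t := q / lam; have t0 : 0 < t by rewrite divr_gt0.
have [_ _ psym CK] := hp.
have mGC := measurableC mG.
have bt0 : 0 <= b / t by rewrite divr_ge0 // ltW.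
have bq0 : 0 <= b * t / q ^+ 2.
  by apply: divr_ge0; [apply: mulr_ge0; exact: ltW|apply: exprn_ge0; exact: ltW].
have pp_meas B : measurable_fun B (fun z => (p t x z * p t z x)%:E).
  apply/measurable_EFinP; apply: measurable_funTS.
  under eq_fun do rewrite (psym t _ x) //.
  by apply: measurable_funM; case: hp => h _ _ _; exact: h.
have dxx : dist x x = 0 by case: hmetric => _ h _ _; apply/h.
have h1 : ((a / (t + t))%:E <= (p (t + t) x x)%:E)%E.
  rewrite lee_fin; apply: p_ge; first exact: addr_gt0.
  by rewrite dxx powR0 ?gt_eqF // addr_ge0 // ltW.
have h2 : (\int[mu]_(z in G x q) (p t x z * p t z x)%:E <= ((b / t) ^+ 2)%:E * mu (G x q))%E.
  rewrite -integral_cst //; apply: ge0_le_integral => //.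
  - by move=> y _; rewrite lee_fin mulr_ge0 // p_ge0.
  - by move=> y _; rewrite lee_fin expr2 ler_pM ?p_ge0 ?p_le.
(* Outside the ball only one factor is bounded pointwise, by the off-diagonal estimate; the other
   integrates to at most 1. *)
have h3 : (\int[mu]_(z in ~` G x q) (p t x z * p t z x)%:E <= (b * t / q ^+ 2)%:E)%E.
  apply: (@le_trans _ _ (\int[mu]_(z in ~` G x q) ((b * t / q ^+ 2)%:E * (p t x z)%:E))%E).
    apply: ge0_le_integral => //.
    - by move=> y _; rewrite lee_fin mulr_ge0 // p_ge0.
    - by apply: measurable_funeM; exact: p_meas.
    - move=> y /= /negP; rewrite -leNgt => qy; rewrite -EFinM lee_fin psym // ler_wpM2r ?p_ge0 //.
      have xy0 : 0 < dist x y.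
        rewrite lt_neqAle dist_ge0 andbT; apply/negP => /eqP e.
        by move: qy; rewrite -e powR0 ?gt_eqF // leNgt q0.
      rewrite psym //; apply: (le_trans (p_le_off t0 xy0)).
      apply: ler_wpM2l; first by apply: mulr_ge0; exact: ltW.
      rewrite lef_pV2 ?posrE ?exprn_gt0 ?powR_gt0 //.
      by rewrite ler_pXn2r // ?nnegrE ?powR_ge0 ?(ltW q0).
  rewrite ge0_integralZl_EFin //; last 2 first.
  - by move=> y _; rewrite lee_fin p_ge0.
  - exact: p_meas.
  rewrite -PE // -[leRHS]mule1 lee_wpmul2l ?lee_fin //.
  by apply: probability_le1; rewrite -[X in measurable X]setTI; apply: X_meas => //; exact: ltW.
have muq := mu_rball_le x q0.
have mufin : mu (G x q) \is a fin_num.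
  by rewrite ge0_fin_numE // (le_lt_trans muq) // ltry.
have : ((a / (t + t))%:E <= ((b / t) ^+ 2)%:E * mu (G x q) + (b * t / q ^+ 2)%:E)%E.
  apply: (le_trans h1); rewrite CK // -(setUv (G x q)) ge0_integral_setU //.
  - exact: leeD.
  - by move=> y _; rewrite lee_fin mulr_ge0 // p_ge0.
  - by rewrite disj_set2E setICr.
rewrite -(fineK mufin) -EFinM -EFinD !lee_fin.
set m := fine _ => h.
have qt : q = lam * t by rewrite /t mulrCA mulfV ?mulr1 // gt_eqF.
(* This dictates [lam]: the outer part is [(b / t) / lam ^ 2], and [lam ^ 2 >= lam >= 4 * b / a], so
   it takes at most half of [a / (2 * t)]. *)
have h4 : b * t / q ^+ 2 <= a / (4 * t).
  have -> : b * t / q ^+ 2 = (b / t) / lam ^+ 2.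
    by rewrite qt; field; rewrite !gt_eqF.
  have -> : a / (4 * t) = (b / t) / (4 * b / a) by field; rewrite !gt_eqF.
  rewrite ler_wpM2l // lef_pV2 ?posrE ?exprn_gt0 // ?divr_gt0 ?mulr_gt0 //.
  by apply: (@le_trans _ _ lam); [rewrite /lam lerDr|rewrite expr2 ler_peMr // ltW].
have h5 : a / (4 * t) <= (b / t) ^+ 2 * m.
  have e : a / (t + t) = a / (4 * t) + a / (4 * t).
    by rewrite -mulr2n; field; rewrite gt_eqF.
  lra.
have -> : volume_const * q = a / (4 * t) / (b / t) ^+ 2.
  by rewrite /volume_const -/lam qt; field; rewrite !gt_eqF.
have bt : 0 < (b / t) ^+ 2 by apply: exprn_gt0; exact: divr_gt0.
by rewrite ler_pdivrMr // [leRHS]mulrC.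
Qed.

Local Notation Q x A := (fine (P x A)).

Let fin_integral (x : M) (A : set Omega) (k : R) : measurable A -> 0 <= k ->
  (\int[P x]_(w in A) cst k%:E w = (k * Q x A)%:E)%E.
Proof. by move=> mA k0; rewrite integral_cst // EFinM fineK // fin_num_measure. Qed.

(** Given the past, the kernel is at most [b / u] everywhere and the ball has volume at most
    [q / a]. *)
Lemma markov_rball_le (x : M) (t u q : R) (A : set Omega) : 0 <= t -> 0 < u -> 0 < q -> Fs t A ->
  Q x (A `&` X (t + u) @^-1` (G x q)) <= b / a * q / u * Q x A.
Proof.
move=> t0 u0 q0 FA; have mG := measurable_rball x q0; have mA := Fs_meas t0 FA.
have k0 : 0 <= b / a * q / u by rewrite !mulr_ge0 ?invr_ge0 // ltW.
have mX : measurable (X (t + u) @^-1` (G x q)).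
  by rewrite -[X in measurable X]setTI; apply: X_meas => //; rewrite addr_ge0 // ltW.
rewrite -lee_fin fineK; last by rewrite fin_num_measure //; exact: measurableI.
rewrite markov //; last exact: ltW.
rewrite -fin_integral //; apply: ge0_le_integral => //.
  by apply: P_meas => //; exact: ltW.
move=> w _ /=; rewrite PE //.
apply: (@le_trans _ _ (\int[mu]_(y in G x q) cst (b / u)%:E y)%E).
  apply: ge0_le_integral => //.
  - by move=> y _; rewrite lee_fin p_ge0.
  - exact: p_meas.
  - by move=> y _; rewrite lee_fin p_le.
rewrite integral_cst //; apply: (@le_trans _ _ ((b / u)%:E * (a^-1 * q)%:E)%E).
  by rewrite lee_wpmul2l ?mu_rball_le // lee_fin divr_ge0 // ltW.
by rewrite -EFinM lee_fin; suff -> : b / u * (a^-1 * q) = b / a * q / u by []; ring.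
Qed.

(** The start lies in the ball of radius [r] and the target in that of radius [q], so their
    rho-distance is at most [2 ^ D * max r q <= u]: the lower kernel bound [a / u] holds on the
    whole target ball. *)
Lemma markov_rball_ge (x : M) (t u q r : R) (A : set Omega) :
  0 <= t -> 0 < u -> 0 < q -> 2 `^ D * q <= u -> 2 `^ D * r <= u ->
  Fs t A -> A `<=` X t @^-1` (G x r) ->
  a * volume_const * q / u * Q x A <= Q x (A `&` X (t + u) @^-1` (G x q)).
Proof.
move=> t0 u0 q0 qu ru FA Ar; have mG := measurable_rball x q0; have mA := Fs_meas t0 FA.
have m0 := volume_const_gt0.
have k0 : 0 <= a * volume_const * q / u.
  by apply: divr_ge0; [apply: mulr_ge0; [apply: mulr_ge0|]|]; exact: ltW.
have mX : measurable (X (t + u) @^-1` (G x q)).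
  by rewrite -[X in measurable X]setTI; apply: X_meas => //; rewrite addr_ge0 // ltW.
rewrite -lee_fin [leRHS]fineK; last by rewrite fin_num_measure //; exact: measurableI.
rewrite markov //; last exact: ltW.
rewrite -fin_integral //; apply: ge0_le_integral => //.
  by apply: P_meas => //; exact: ltW.
move=> w Aw /=; rewrite PE //.
apply: (@le_trans _ _ (\int[mu]_(y in G x q) cst (a / u)%:E y)%E); last first.
  apply: ge0_le_integral => //.
  - by move=> y _ /=; rewrite lee_fin divr_ge0 // ltW.
  - exact: p_meas.
  - move=> y /= yq; rewrite lee_fin; apply: p_ge => //.
    apply: (@le_trans _ _ (2 `^ D * Num.max r q)); last first.
      by have [_|_] := leP r q.
    apply: (@dist_powR_max x); rewrite le_max; apply/orP; [left|right]; apply: ltW => //.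
    exact: (Ar w Aw).
rewrite integral_cst //; apply: (@le_trans _ _ ((a / u)%:E * (volume_const * q)%:E)%E).
  rewrite -EFinM lee_fin; suff -> : a / u * (volume_const * q) = a * volume_const * q / u by [].
  ring.
by rewrite lee_wpmul2l ?mu_rball_ge // lee_fin divr_ge0 // ltW.
Qed.

(** Balls of integer radius exhaust the space, so continuity from below applies. *)
Lemma rball_tight (x : M) (t e : R) : 0 <= t -> 0 < e ->
  exists2 q, 0 < q & Q x (~` (X t @^-1` (G x q))) <= e.
Proof.
move=> t0 e0; pose F n := X t @^-1` (G x n.+1%:R).
have mF n : measurable (F n).
  by rewrite -[X in measurable X]setTI; apply: X_meas => //; exact: measurable_rball.
have UF : \bigcup_n F n = setT.
  apply/seteqP; split => // w _; exists (Num.truncn (dist x (X t w) `^ D)) => //.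
  by rewrite /F /= /rball /=; exact: truncnS_gt.
have cv : (P x \o F) @ \oo --> 1%:E.
  have -> : 1%:E = P x (\bigcup_n F n) by rewrite UF probability_setT.
  apply: nondecreasing_cvg_mu => //; first by rewrite UF.
  move=> n m nm; apply/subsetPset => w; rewrite /F /= /rball /= => /lt_le_trans; apply.
  by rewrite ler_nat.
have : \forall n \near \oo, 1 - e < (fine \o (P x \o F)) n.
  by apply: (cvgr_gt _ (fine_cvg cv)); rewrite ltrBlDr ltrDl.
case=> n _ /(_ n (leqnn n)) /= h; exists n.+1%:R => //.
have := fine_probU (P x) (mF n) (measurableC (mF n)) (setICr _).
rewrite setUv probability_setT /= => e1; rewrite -/(F n); lra.
Qed.

End rball_theory.

(** * Visits to shrinking balls *)

(** The logarithm telescopes, and [ln (1 + 1 / n) <= 1 / n]. *)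
Lemma sum_inv_ge_ln (R : realType) (m n : nat) : (0 < m)%N -> (m <= n)%N ->
  ln (n%:R / m%:R : R) <= \sum_(m <= k < n) k%:R^-1.
Proof.
move=> m0; elim: n => [|n IH] mn; first by move: m0; rewrite lt0n; case: m mn.
move: mn; rewrite leq_eqVlt => /orP[/eqP <-|]; first by rewrite divff ?pnatr_eq0 ?gtn_eqF // ln1 big_geq.
rewrite ltnS => mn; have n0 : (0 < n)%N by exact: leq_trans mn.
have nR : 0 < n%:R :> R by rewrite ltr0n.
have mR : 0 < m%:R :> R by rewrite ltr0n.
rewrite big_nat_recr //=.
have -> : n.+1%:R / m%:R = (n%:R / m%:R) * (1 + n%:R^-1) :> R.
  by rewrite -natr1; field; rewrite !gt_eqF.
rewrite lnM ?posrE ?divr_gt0 ?addr_gt0 ?invr_gt0 // lerD ?IH //.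
by apply: le_ln1Dx; apply: (@lt_trans _ _ 0); rewrite ?invr_gt0 // ltrN10.
Qed.

Lemma sum_inv_le_ln (R : realType) (m n : nat) : (0 < m)%N -> (m <= n)%N ->
  \sum_(m <= k < n) k%:R^-1 <= 1 + ln (n%:R / m%:R : R).
Proof.
move=> m0 mn.
(* The shifted sum is below the logarithm, by [ln (1 - x) <= - x]; the unshifted one has the
   additional first term [1 / m <= 1]. *)
have h : \sum_(m <= k < n) k.+1%:R^-1 <= ln (n%:R / m%:R : R).
  elim: n mn => [|n IH] mn; first by move: m0; rewrite lt0n; case: m mn.
  move: mn; rewrite leq_eqVlt => /orP[/eqP <-|]; first by rewrite divff ?pnatr_eq0 ?gtn_eqF // ln1 big_geq.
  rewrite ltnS => mn; have n0 : (0 < n)%N by exact: leq_trans mn.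
  have nR : 0 < n%:R :> R by rewrite ltr0n.
  have nR1 : 0 < n.+1%:R :> R by rewrite ltr0n.
  have mR : 0 < m%:R :> R by rewrite ltr0n.
  rewrite big_nat_recr //=.
  have -> : n.+1%:R / m%:R = (n%:R / m%:R) / (1 - n.+1%:R^-1) :> R.
    have -> : 1 - n.+1%:R^-1 = n%:R / n.+1%:R :> R.
      by rewrite -natr1; field; rewrite gt_eqF // addr_gt0.
    by field; rewrite !gt_eqF.
  have i1 : n.+1%:R^-1 < 1 :> R by rewrite invf_lt1 // ltr1n ltnS.
  rewrite ln_div ?posrE ?divr_gt0 ?subr_gt0 // lerD ?IH //.
  rewrite lerNr; apply: le_ln1Dx; by rewrite ltrN2.
have mi : m%:R^-1 <= 1 :> R by rewrite invf_le1 ?ltr0n // ler1n.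
have := mn; rewrite leq_eqVlt => /orP[/eqP <-|mn'].
  by rewrite big_geq // divff ?pnatr_eq0 ?gtn_eqF // ln1 addr0.
rewrite big_ltn //; apply: lerD => //; case: n mn mn' h => // n mn mn' h.
rewrite big_add1 /=; apply: (le_trans _ h).
by rewrite big_nat_recr //= lerDl invr_ge0.
Qed.

Lemma ceil_nat (R : realType) (x : R) : 1 <= x -> exists2 k : nat, (0 < k)%N & x <= k%:R <= 2 * x.
Proof.
move=> x1; exists (Num.truncn x).+1 => //.
have x0 : 0 <= x by exact: le_trans x1.
by rewrite ltW ?truncnS_gt //= -natr1 mulrDl mul1r lerD // truncn_le.
Qed.

Lemma sum_nat_if_le (R : realType) (f : nat -> R) (j a b n : nat) : (forall l, 0 <= f l) ->
  (b <= n)%N -> (j <= n)%N ->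
  \sum_(a <= l < b) (if (j <= l)%N then f l else 0) <= \sum_(j <= l < n) f l.
Proof.
move=> f0 bn jn; have g0 l : 0 <= (if (j <= l)%N then f l else 0) by case: ifP.
have [ab|ba] := leqP a b; last by rewrite big_geq ?sumr_ge0 // ltnW.
apply: (@le_trans _ _ (\sum_(0 <= l < n) (if (j <= l)%N then f l else 0))).
  rewrite [leRHS](@big_cat_nat _ _ _ b) //= [X in _ <= X + _](@big_cat_nat _ _ _ a) //=.
  by rewrite ler_wpDr ?ler_wpDl ?sumr_ge0.
rewrite (@big_cat_nat _ _ _ j) //= big_nat big1 ?add0r; last first.
  by move=> l /andP[_ lj]; rewrite leqNgt lj.
by apply: ler_sum_nat => l /andP[-> _].
Qed.

(** On the time grid of mesh [4 ^ - e], the window [[4 ^ k, 4 ^ k.+1)] consists of the indices from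
    [4 ^ (k + e)] to just before [4 ^ (k.+1 + e)]. *)
Lemma sum_windows (R : realType) (f : nat -> R) (e n m : nat) : (n <= m)%N ->
  \sum_(4 ^ (n + e) <= l < 4 ^ (m + e)) f l =
  \sum_(n <= k < m) \sum_(4 ^ (k + e) <= l < 4 ^ (k.+1 + e)) f l.
Proof.
elim: m => [|m IH]; first by rewrite leqn0 => /eqP ->; rewrite !big_geq.
rewrite leq_eqVlt => /orP[/eqP ->|]; first by rewrite !big_geq.
rewrite ltnS => nm; rewrite (@big_cat_nat _ _ _ (4 ^ (m + e))) /=; last 2 first.
- by rewrite leq_exp2l // leq_add2r.
- by rewrite leq_exp2l // leq_add2r.
by rewrite IH // big_nat_recr.
Qed.

Lemma window_index (e n l : nat) : (4 ^ (n + e) <= l < 4 ^ (n.+1 + e))%N ->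
  (trunc_log 4 l - e = n)%N.
Proof. by move=> h; rewrite (@trunc_log_eq 4 (n + e)) // addnK. Qed.

Lemma sum_indicator_le1 (R : realType) (p n m : nat) :
  \sum_(n <= k < m) (k == p)%:R <= 1 :> R.
Proof.
elim: m => [|m IH]; first by rewrite big_geq.
have [nm|mn] := leqP n m; last by rewrite big_geq.
rewrite big_nat_recr //=; have [->|_] := eqVneq m p; last by rewrite addr0.
rewrite big_nat big1 ?add0r // => k /andP[_ kp]; by rewrite ltn_eqF.
Qed.

(** Provides one mesh that is finer than the radii of all the finitely many windows in play. *)
Lemma ex_pow_inv_le (R : realType) (q : nat -> R) (m : nat) : (forall n, 0 < q n) ->
  exists e, forall n, (n < m)%N -> (4 ^ e)%:R^-1 <= q n.
Proof.
move=> q0; elim: m => [|m [e IH]]; first by exists 0%N.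
exists (maxn e (Num.truncn (q m)^-1).+1) => n.
have p4 k : 0 < (4 ^ k)%:R :> R by rewrite ltr0n expn_gt0.
rewrite ltnS leq_eqVlt => /orP[/eqP ->|nm].
  rewrite -[leRHS]invrK lef_pV2 ?posrE ?invr_gt0 //.
  apply: ltW; apply: (lt_le_trans (truncnS_gt _)); rewrite ler_nat.
  by apply: (leq_trans (leq_maxr e _)); rewrite ltnW // ltn_expl.
apply: le_trans (IH n nm); rewrite lef_pV2 ?posrE // ler_nat leq_exp2l //.
exact: leq_maxl.
Qed.

(** * Abstract critical process: hitting a small ball during one window *)

Section critical_process.
Variables (R : realType) (dO : measure_display) (Omega : measurableType dO).
Variables (P : probability Omega R) (Fs : R -> set (set Omega)).
(* [H q t] is the event that at time [t] the process is in the ball of [rho]-radius [q];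
   [K] is such that [rho y z <= K * q] for [y], [z] in this ball. *)
Variables (H : R -> R -> set Omega) (C c K : R).
Local Notation Q A := (fine (P A)).
Hypothesis C0 : 0 < C.
Hypothesis c0 : 0 < c.
Hypothesis K1 : 1 <= K.
Hypothesis Fs_meas : forall (t : R) A, 0 <= t -> Fs t A -> measurable A.
Hypothesis Fs_sigma : forall t : R, 0 <= t -> sigma_algebra setT (Fs t).
Hypothesis Fs_mono : forall s t : R, 0 <= s -> s <= t -> Fs s `<=` Fs t.
Hypothesis FsH : forall q t : R, 0 <= t -> 0 < q -> Fs t (H q t).
Hypothesis H_le : forall (t u q : R) A, 0 <= t -> 0 < u -> 0 < q -> Fs t A ->
  Q (A `&` H q (t + u)) <= C * q / u * Q A.
Hypothesis H_ge : forall (t u q r : R) A, 0 <= t -> 0 < u -> 0 < q ->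
  K * q <= u -> K * r <= u -> Fs t A -> A `<=` H r t ->
  c * q / u * Q A <= Q (A `&` H q (t + u)).

Let K0 : 0 < K. Proof. exact: lt_le_trans K1. Qed.

Let FsI (t : R) A B : 0 <= t -> Fs t A -> Fs t B -> Fs t (A `&` B).
Proof. by move=> t0; apply: sigma_algebra_setI; exact: Fs_sigma. Qed.

Let FsD (t : R) A B : 0 <= t -> Fs t A -> Fs t B -> Fs t (A `\` B).
Proof. by move=> t0; apply: sigma_algebra_setD; exact: Fs_sigma. Qed.

Let FsT (t : R) : 0 <= t -> Fs t setT.
Proof. by move=> t0; have [F0 FC _] := Fs_sigma t0; rewrite -(setD0 setT); exact: FC. Qed.

Let grid_bounds (j k N : nat) : (j < 3 * N)%N -> (k <= N)%N ->
  [/\ j <= j + k, j + k <= j + N & j + N <= 4 * N]%N.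
Proof. by move=> jN kN; split; rewrite ?leq_addr ?leq_add2l // mulSn addnC leq_add2l ltnW. Qed.

(** Two bounds on the expected number of visits on the grid of mesh [h]: at most [4 * N * C * q / t]
    in all, but at least [th], of order [(q / h) * ln (t / q)], after any first visit. Their
    quotient does not involve the mesh, since [N * h = t]. *)
Lemma hit_grid_le (t q : R) (N : nat) : 0 < t -> 0 < q -> (0 < N)%N -> t / N%:R <= K * q ->
  2 * K * q < t ->
  Q (hit (fun i => H q (t + i%:R * (t / N%:R))) 0 (3 * N)) <= 4 * C / c / ln (t / (2 * K * q)).
Proof.
move=> t0 q0 N0; set h := t / N%:R => hK Kt.
have NR : 0 < N%:R :> R by rewrite ltr0n.
have h0 : 0 < h by rewrite divr_gt0.
have Kq : 0 < K * q by rewrite mulr_gt0.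
have tNh : t = N%:R * h by rewrite /h mulrC divfK // gt_eqF.
pose T i := t + i%:R * h.
have T0 i : 0 <= T i by rewrite addr_ge0 ?mulr_ge0 // ltW.
(* From [k0] steps after a visit onwards, the elapsed time is at least [K * q], as [H_ge]
   demands. *)
have [k0 k00 /andP[k1 k2]] : exists2 k : nat, (0 < k)%N & K * q / h <= k%:R <= 2 * (K * q / h).
  by apply: ceil_nat; rewrite ler_pdivlMr // mul1r.
have k0R : 0 < k0%:R :> R by rewrite ltr0n.
have k0N : (k0 <= N)%N.
  rewrite -(ler_nat R); apply: (le_trans k2); rewrite mulrA ler_pdivrMr // -tNh mulrA; exact: ltW.
have ln0 : 0 < ln (t / (2 * K * q)).
  by apply: ln_gt0; rewrite ltr_pdivlMr ?mul1r // -mulrA mulr_gt0.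
pose th := c * q / h * ln (t / (2 * K * q)).
have th0 : 0 < th by rewrite /th mulr_gt0 // divr_gt0 // mulr_gt0.
(* The first [3 * N] indices cover [[t, 4 * t)]; summing up to [4 * N] leaves [N] more indices after
   each first visit, of which those at offsets [k0] to [N - 1] are kept. *)
have key : th * Q (setT `&` hit (fun i => H q (T i)) 0 (3 * N)) <=
    \sum_(0 <= l < 4 * N) 1 * Q (setT `&` H q (T l)).
  apply: (@first_entrance_ge _ _ _ P (fun i => Fs (T i)) (fun i => H q (T i)) (fun=> 1)) => //.
  - by move=> i A; exact: Fs_meas.
  - by move=> i A B; exact: FsI.
  - by move=> i A B; exact: FsD.
  - move=> i A; apply: Fs_mono => //; rewrite /T lerD2l ler_wpM2r ?(ltW h0) // ler_nat //.
  - by move=> i; exact: FsH.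
  - by rewrite leq_mul2r orbT.
  - move=> j A /andP[_ jN] FA Aj.
    have [jk kN jN4] := grid_bounds jN k0N.
    rewrite (@big_cat_nat _ _ _ (j + k0)) //=; last exact: leq_trans jN4.
    rewrite (@big_cat_nat _ _ _ (j + N) (j + k0)) //=.
    apply: ler_wpDl; first by apply: sumr_ge0 => l _; rewrite mul1r fine_prob_ge0.
    apply: ler_wpDr; first by apply: sumr_ge0 => l _; rewrite mul1r fine_prob_ge0.
    rewrite [(j + k0)%N]addnC big_addn addKn.
    apply: (@le_trans _ _ (\sum_(k0 <= k < N) (c * q / h * Q A) * k%:R^-1)).
      rewrite -mulr_sumr /th -mulrA [ln _ * _]mulrC mulrA ler_wpM2l //.
        by rewrite mulr_ge0 ?fine_prob_ge0 // divr_ge0 ?mulr_ge0 // ltW.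
      apply: (le_trans _ (sum_inv_ge_ln R k00 k0N)).
      have Nk : t / (2 * K * q) <= N%:R / k0%:R.
        rewrite tNh -mulrA ler_wpM2l ?(ltW NR) // ler_pdivrMr; last by rewrite -mulrA mulr_gt0.
        rewrite mulrC ler_pdivlMr // mulrC -ler_pdivlMr // -mulrA; apply: (le_trans k2).
        by rewrite mulrA.
      by rewrite ler_ln // posrE divr_gt0 // -mulrA mulr_gt0.
    apply: ler_sum_nat => k /andP[kk _].
    have kR : 0 < k%:R :> R by rewrite ltr0n (leq_trans k00).
    have -> : T (k + j)%N = T j + k%:R * h by rewrite /T natrD mulrDl addrAC addrA.
    have Kk : K * q <= k%:R * h.
      by rewrite -ler_pdivrMr // (le_trans k1) // ler_nat.
    rewrite mul1r; apply: le_trans (H_ge (T0 j) _ q0 Kk Kk FA Aj); last exact: mulr_gt0.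
    have -> // : c * q / h * Q A / k%:R = c * q / (k%:R * h) * Q A.
    by field; rewrite !gt_eqF.
  - exact: FsT.
rewrite setTI in key; rewrite -(@ler_pM2l _ th) //; apply: (le_trans key).
apply: (@le_trans _ _ (\sum_(0 <= l < 4 * N) (C * q / t))).
  apply: ler_sum => l _; rewrite mul1r setTI.
  have Tl : 0 < T l by rewrite /T ltr_wpDr ?mulr_ge0 // ltW.
  have := H_le (lexx 0) Tl q0 (FsT (lexx 0)); rewrite setTI add0r probability_setT /= mulr1.
  move=> /le_trans; apply; rewrite ler_wpM2l ?mulr_ge0 ?(ltW C0) ?(ltW q0) //.
  by rewrite lef_pV2 ?posrE // /T lerDl mulr_ge0 // ltW.
rewrite sumr_const_nat subn0 -[leLHS]mulr_natr natrM /th.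
have -> // : C * q / t * (4%:R * N%:R) = c * q / h * ln (t / (2 * K * q)) * (4 * C / c / ln (t / (2 * K * q))).
set Lg := ln _ in ln0 *; by rewrite tNh; field; rewrite !gt_eqF.
Qed.

(** Visits during [[t, 4 * t)] observed on dyadic grids: a countable union, hence measurable, which
    still catches every visit that lasts a positive time. *)
Definition window_hit (t q : R) : set Omega :=
  \bigcup_e hit (fun i => H q (t + i%:R * (t / (2 ^ e)%:R))) 0 (3 * 2 ^ e).

Lemma measurable_window_hit (t q : R) : 0 < t -> 0 < q -> measurable (window_hit t q).
Proof.
move=> t0 q0; apply: bigcup_measurable => e _; apply: bigcup_measurable => i _.
have h0 : 0 <= t + i%:R * (t / (2 ^ e)%:R) by rewrite addr_ge0 ?mulr_ge0 ?divr_ge0 // ltW.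
exact: Fs_meas (FsH h0 q0).
Qed.

(** The dyadic grids are nested and the grid bound is uniform in the mesh, so it passes to the
    increasing union. *)
Lemma window_hit_le (t q : R) : 0 < t -> 0 < q -> 2 * K * q < t ->
  (P (window_hit t q) <= (4 * C / c / ln (t / (2 * K * q)))%:E)%E.
Proof.
move=> t0 q0 Kt.
pose F e := hit (fun i => H q (t + i%:R * (t / (2 ^ e)%:R))) 0 (3 * 2 ^ e).
have T0 e i : 0 <= t + i%:R * (t / (2 ^ e)%:R) by rewrite addr_ge0 ?mulr_ge0 ?divr_ge0 // ltW.
have mF e : measurable (F e).
  by apply: bigcup_measurable => i _; exact: Fs_meas (FsH (T0 e i) q0).
have F_nd : {homo F : n m / (n <= m)%N >-> (n <= m)%O}.
  move=> n m nm; apply/subsetPset => w [i /= i3 Hi]; exists (i * 2 ^ (m - n))%N => /=.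
    by rewrite -(subnK nm) expnD addnK; have := expn_gt0 2 (m - n); nia.
  move: Hi; congr (H q _ w); congr (t + _).
  rewrite -{2}(subnK nm) expnD !natrM; field.
  by rewrite !pnatr_eq0 -!lt0n !expn_gt0.
have cv : (P \o F) @ \oo --> P (window_hit t q).
  apply: nondecreasing_cvg_mu => //; exact: measurable_window_hit.
rewrite -(cvg_lim _ cv) //; apply: lime_le; first by apply/cvg_ex; eexists; exact: cv.
(* From this level on the mesh is at most [K * q], as the grid bound requires. *)
exists (Num.truncn (t / (K * q))).+1 => // e /= he.
rewrite -[P (F e)]fineK ?fin_num_measure // lee_fin; apply: hit_grid_le => //.
  by rewrite expn_gt0.
have Kq : 0 < K * q by rewrite mulr_gt0.
rewrite ler_pdivrMr ?ltr0n ?expn_gt0 // mulrC -ler_pdivrMr //.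
apply: ltW; apply: (lt_le_trans (truncnS_gt _)).
by rewrite ler_nat (leq_trans he) // ltnW // ltn_expl.
Qed.

Lemma mem_window_hit (t q s d : R) (w : Omega) : 0 < t -> t <= s < 4 * t -> 0 < d ->
  (forall s', s <= s' < s + d -> H q s' w) -> window_hit t q w.
Proof.
move=> t0 /andP[ts st] d0 Hs.
(* The mesh must be smaller than the duration [d] of the visit and also than the time left before
   [4 * t], so that the first grid time after [s] lies in both. *)
pose r := Num.min d (4 * t - s).
have r0 : 0 < r by rewrite lt_min d0 subr_gt0.
pose e := (Num.truncn (t / r)).+1.
have eR : 0 < (2 ^ e)%:R :> R by rewrite ltr0n expn_gt0.
pose h := t / (2 ^ e)%:R.
have h0 : 0 < h by rewrite divr_gt0.
have hr : h < r.
  rewrite /h ltr_pdivrMr // mulrC -ltr_pdivrMr //.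
  apply: (lt_trans (truncnS_gt _)); by rewrite ltr_nat ltn_expl.
have [hd hs] : h < d /\ h < 4 * t - s by move: hr; rewrite lt_min => /andP.
pose i := (Num.truncn ((s - t) / h)).+1.
have sth : 0 <= (s - t) / h by rewrite divr_ge0 ?subr_ge0 // ltW.
have i1 : s - t < i%:R * h by rewrite -ltr_pdivrMr // truncnS_gt.
have i2 : i%:R * h <= s - t + h.
  by rewrite /i -natr1 mulrDl mul1r lerD2r -ler_pdivlMr // truncn_le.
exists e => //; exists i => /=.
  have eh : (2 ^ e)%:R * h = t by rewrite /h mulrC divfK // gt_eqF.
  rewrite -(ltr_nat R) -(@ltr_pM2r _ h) //.
  have -> : (3 * 2 ^ e)%:R * h = 3 * t by rewrite natrM -eh mulrA.
  lra.
apply: Hs; rewrite -/h; lra.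
Qed.

(** * Weighted visits to balls that shrink from window to window *)

Variables (q a : nat -> R) (B : R) (ns : nat).
Hypothesis q0 : forall n, 0 < q n.
Hypothesis a0 : forall n, (ns <= n)%N -> 0 < a n.
Hypothesis a1 : forall n, (ns <= n)%N -> a n <= 1.
Hypothesis B0 : 0 <= B.
Hypothesis Kq : forall n, (ns <= n)%N -> 2 * K * q n <= (4 ^ n)%:R.
Hypothesis lnq : forall n, (ns <= n)%N -> ln ((4 ^ n.+1)%:R / q n) <= B / a n.

Let p4 k : 0 < (4 ^ k)%:R :> R. Proof. by rewrite ltr0n expn_gt0. Qed.
Local Notation h e := ((4 ^ e)%:R^-1 : R).
Let h0 e : 0 < h e. Proof. by rewrite invr_gt0. Qed.
Let C1 := 2 + C + C * B.
Let C10 : 0 < C1. Proof. by rewrite /C1 ltr_wpDr ?addr_gt0 // mulr_ge0 // ltW. Qed.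
Let T0 e (l : nat) : 0 <= l%:R * h e. Proof. by rewrite mulr_ge0 // ltW. Qed.
Let mH x e (l : nat) : 0 < x -> measurable (H x (l%:R * h e)).
Proof. by move=> x0; exact: Fs_meas (FsH (T0 e l) x0). Qed.

(* Each visit in the [n]-th window gets the weight [h e * a n / q n], so that the expected
   weighted number of visits in this window is of order [a n]. *)
Let window_weight n e : 0 < q n -> \sum_(4 ^ (n + e) <= l < 4 ^ (n.+1 + e)) (h e * a n / q n) =
  3 * (4 ^ n)%:R * a n / q n.
Proof.
move=> qn; rewrite sumr_const_nat -[LHS]mulr_natr.
have -> : (4 ^ (n.+1 + e) - 4 ^ (n + e) = 3 * 4 ^ n * 4 ^ e)%N.
  by rewrite !expnD expnS -mulnBl -{2}[(4 ^ n)%N]mul1n -mulnBl.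
by rewrite !natrM; field; rewrite !gt_eqF.
Qed.

(** The bound for windows close to the present time [j * h e]. During the first [q n] or so of
    elapsed time the probabilities are bounded trivially, giving [2 * a n]; afterwards they decay
    like [1 / k] and sum to a logarithm, which [lnq] bounds by [B / a n]. *)
Lemma window_occupation_le n e j A : (ns <= n)%N -> h e <= q n -> Fs (j%:R * h e) A ->
  \sum_(4 ^ (n + e) <= l < 4 ^ (n.+1 + e))
     (if (j <= l)%N then h e * a n / q n * Q (A `&` H (q n) (l%:R * h e)) else 0) <= C1 * Q A.
Proof.
move=> nns hq FA; set L := (4 ^ (n.+1 + e))%N.
have mA := Fs_meas (T0 e j) FA; have QA := fine_prob_ge0 P A.
have an := a0 nns; have qn := q0 n; have he := h0 e.
have w0 : 0 < h e * a n / q n by rewrite divr_gt0 // mulr_gt0.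
pose f l := h e * a n / q n * Q (A `&` H (q n) (l%:R * h e)).
have f0 l : 0 <= f l by rewrite /f mulr_ge0 ?fine_prob_ge0 // ltW.
(* The range is enlarged so as to be indexed by the offset from [j], running from 0 to [L]. *)
apply: (@le_trans _ _ (\sum_(j <= l < L + j) f l)).
  by apply: sum_nat_if_le; rewrite ?leq_addr ?leq_addl.
rewrite -{1}[j]add0n big_addn addnK.
have [M M0 /andP[M1 M2]] : exists2 k : nat, (0 < k)%N & q n / h e <= k%:R <= 2 * (q n / h e).
  by apply: ceil_nat; rewrite ler_pdivlMr // mul1r.
have MR : 0 < M%:R :> R by rewrite ltr0n.
have LR : L%:R = 4 * (4 ^ n)%:R * (4 ^ e)%:R :> R by rewrite /L expnD expnS !natrM.
have K2 : 2 * q n <= (4 ^ n)%:R.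
  by apply: le_trans (Kq nns); rewrite ler_pM2r // ler_peMr.
have ML : (M <= L)%N.
  rewrite -(ler_nat R) LR; apply: (le_trans M2); rewrite invrK mulrA ler_pM2r //.
  by apply: (le_trans K2); rewrite ler_peMl ?ltW // ltr1n.
rewrite (@big_cat_nat _ _ _ M) //=.
have s1 : \sum_(0 <= k < M) f (k + j)%N <= (2 * a n) * Q A.
  apply: (@le_trans _ _ (\sum_(0 <= k < M) (h e * a n / q n * Q A))).
    apply: ler_sum => k _; rewrite /f ler_pM2l //; apply: le_fine_prob => //.
    by apply: measurableI => //; exact: mH.
  rewrite sumr_const_nat subn0 -[leLHS]mulr_natr mulrAC ler_wpM2r //.
  apply: (@le_trans _ _ (h e * a n / q n * (2 * (q n / h e)))); first by rewrite ler_pM2l.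
  have -> // : h e * a n / q n * (2 * (q n / h e)) = 2 * a n.
  by field; rewrite !gt_eqF.
have s2 : \sum_(M <= k < L) f (k + j)%N <= (C * a n * (1 + B / a n)) * Q A.
  apply: (@le_trans _ _ (\sum_(M <= k < L) ((C * a n * Q A) * k%:R^-1))).
    apply: ler_sum_nat => k /andP[Mk _].
    have kR : 0 < k%:R :> R by rewrite ltr0n (leq_trans M0).
    have kh : 0 < k%:R * h e by rewrite mulr_gt0.
    have := H_le (T0 e j) kh qn FA; rewrite -mulrDl -natrD addnC => Hl.
    apply: (@le_trans _ _ (h e * a n / q n * (C * q n / (k%:R * h e) * Q A))).
      by rewrite /f ler_pM2l.
    have -> // : h e * a n / q n * (C * q n / (k%:R * h e) * Q A) = C * a n * Q A / k%:R.
    by field; rewrite !gt_eqF.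
  rewrite -mulr_sumr [leRHS]mulrAC ler_wpM2l ?mulr_ge0 ?(ltW C0) ?(ltW an) //.
  apply: (le_trans (sum_inv_le_ln R M0 ML)); rewrite lerD2l; apply: le_trans (lnq nns).
  rewrite ler_ln ?posrE ?divr_gt0 ?LR ?mulr_gt0 //.
  rewrite expnS natrM -(mulrA (4 * _)) ler_pM2l ?mulr_gt0 // ler_pdivrMr //.
  by rewrite ler_pdivlMl //; move: M1; rewrite invrK.
apply: (le_trans (lerD s1 s2)); rewrite -mulrDl ler_wpM2r //.
have -> : C * a n * (1 + B / a n) = C * a n + C * B by field; rewrite gt_eqF.
rewrite /C1 addrA lerD2r; apply: lerD; rewrite ler_piMr ?(ltW C0) ?a1 //.
Qed.

(** The present is at most a quarter of the way to the window, so at least [4 ^ n / 2] elapses and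
    no logarithm appears: the bound is proportional to [a n]. *)
Lemma far_window_occupation_le n e j A : (ns <= n)%N -> (4 * j <= 4 ^ (n + e))%N ->
  Fs (j%:R * h e) A ->
  \sum_(4 ^ (n + e) <= l < 4 ^ (n.+1 + e))
     h e * a n / q n * Q (A `&` H (q n) (l%:R * h e)) <= 6 * C * a n * Q A.
Proof.
move=> nns j4 FA; have QA := fine_prob_ge0 P A.
have an := a0 nns; have qn := q0 n; have he := h0 e.
have w0 : 0 < h e * a n / q n by rewrite divr_gt0 // mulr_gt0.
apply: (@le_trans _ _ (\sum_(4 ^ (n + e) <= l < 4 ^ (n.+1 + e))
    (h e * a n / q n) * (2 * C * q n / (4 ^ n)%:R * Q A))); last first.
  rewrite -mulr_suml window_weight //.
  have -> // : 3 * (4 ^ n)%:R * a n / q n * (2 * C * q n / (4 ^ n)%:R * Q A) = 6 * C * a n * Q A.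
  by field; rewrite !gt_eqF.
apply: ler_sum_nat => l /andP[l1 _].
rewrite ler_pM2l //.
pose u := l%:R * h e - j%:R * h e.
have hu : (4 ^ n)%:R / 2 <= u.
  have l1R : (4 ^ n)%:R * (4 ^ e)%:R <= l%:R :> R by rewrite -natrM -expnD ler_nat.
  have j4R : 4 * j%:R <= (4 ^ n)%:R * (4 ^ e)%:R :> R by rewrite -!natrM -expnD ler_nat.
  rewrite /u -mulrBl ler_pdivlMr //.
  have n0 := ltW (mulr_gt0 (p4 n) (p4 e)); rewrite mulrAC ler_pdivrMr //; lra.
have u0 : 0 < u by apply: lt_le_trans hu; rewrite divr_gt0.
have := H_le (T0 e j) u0 qn FA; rewrite /u subrKC -/u => /le_trans; apply.
rewrite ler_wpM2r //.
have -> : 2 * C * q n / (4 ^ n)%:R = C * q n / ((4 ^ n)%:R / 2) by field; rewrite gt_eqF.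
by rewrite ler_pM2l ?mulr_gt0 // lef_pV2 ?posrE ?divr_gt0.
Qed.

(** Between [4 ^ n / 2] and [4 * 4 ^ n] elapses from [T] to any time of the window, so each visit
    has conditional probability at least [c * q n / (4 * 4 ^ n)]. *)
Lemma window_occupation_ge n e (T r : R) A : (ns <= n)%N -> 0 <= T -> 2 * T <= (4 ^ n)%:R ->
  2 * K * r <= (4 ^ n)%:R -> Fs T A -> A `<=` H r T ->
  3 / 4 * c * a n * Q A <= \sum_(4 ^ (n + e) <= l < 4 ^ (n.+1 + e))
     h e * a n / q n * Q (A `&` H (q n) (l%:R * h e)).
Proof.
move=> nns TT T4 r4 FA Ar; have QA := fine_prob_ge0 P A.
have an := a0 nns; have qn := q0 n; have he := h0 e; have K4 := Kq nns.
have w0 : 0 < h e * a n / q n by rewrite divr_gt0 // mulr_gt0.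
apply: (@le_trans _ _ (\sum_(4 ^ (n + e) <= l < 4 ^ (n.+1 + e))
    (h e * a n / q n) * (c * q n / (4 * (4 ^ n)%:R) * Q A))).
  rewrite -mulr_suml window_weight //.
  have -> // : 3 * (4 ^ n)%:R * a n / q n * (c * q n / (4 * (4 ^ n)%:R) * Q A) = 3 / 4 * c * a n * Q A.
  by field; rewrite !gt_eqF.
apply: ler_sum_nat => l /andP[l1 l2].
rewrite ler_pM2l //.
pose u := l%:R * h e - T.
have l1R : (4 ^ n)%:R <= l%:R * h e by rewrite ler_pdivlMr // -natrM -expnD ler_nat.
have l2R : l%:R * h e <= 4 * (4 ^ n)%:R.
  by rewrite ler_pdivrMr // -!natrM -expnS -expnD ler_nat ltnW.
have u4 : (4 ^ n)%:R <= 2 * u by rewrite /u mulrBr; lra.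
have u0 : 0 < u by have := p4 n; lra.
have uq : K * q n <= u by lra.
have ur : K * r <= u by lra.
have := H_ge TT u0 qn uq ur FA Ar; rewrite /u subrKC -/u; apply: le_trans.
by rewrite ler_wpM2r // ler_pM2l ?mulr_gt0 // lef_pV2 ?posrE ?mulr_gt0 // /u; lra.
Qed.

Hypothesis diverges : forall n0, exists m, 1 <= \sum_(n0 <= n < m) a n.

(** Quotient of the lower and upper occupation constants: two near windows cost [C1 = 2 + C + C * B]
    each, the far ones [6 * C] per unit of the sum of the [a n]. *)
Definition hit_fraction := 3 / 4 * c / (2 * (2 + C + C * B) + 6 * C).

Lemma hit_fraction_gt0 : 0 < hit_fraction.
Proof. by rewrite divr_gt0 ?mulr_gt0 ?divr_gt0 // addr_gt0 ?mulr_gt0. Qed.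

(** The expected weighted number of visits over finitely many late windows is at least of order
    [S * Q A], and by first-visit decomposition at most of order [S * Q (A & Hit)]; hence a hit with
    a conditional probability that depends neither on [T] nor on [r]. *)
Lemma hit_windows (n0 : nat) (T r : R) A : 0 <= T -> Fs T A -> A `<=` H r T ->
  exists T2 : R, exists Hit : set Omega, [/\ T <= T2, Fs T2 Hit,
    (forall w, Hit w -> exists n s, [/\ (n0 <= n)%N, (4 ^ n)%:R <= s, s <= (4 ^ n.+1)%:R & H (q n) s w]) &
    hit_fraction * Q A <= Q (A `&` Hit)].
Proof.
move=> TT FA Ar; have QA := fine_prob_ge0 P A.
(* The windows start late enough for [4 ^ n] to exceed both [2 * T] and [2 * K * r]. *)
pose n1 := maxn (maxn ns n0) (maxn (Num.truncn (2 * T)).+1 (Num.truncn (2 * K * r)).+1).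
have n1ns : (ns <= n1)%N by rewrite /n1 -maxnA leq_maxl.
have n1n0 : (n0 <= n1)%N by rewrite /n1 [maxn ns _]maxnC -maxnA leq_maxl.
have big4 (x : R) : ((Num.truncn x).+1 <= n1)%N -> forall n, (n1 <= n)%N -> x <= (4 ^ n)%:R.
  move=> xn n nn; apply: ltW; apply: (lt_le_trans (truncnS_gt x)).
  by rewrite ler_nat (leq_trans xn) // (leq_trans nn) // ltnW // ltn_expl.
have T4 : forall n, (n1 <= n)%N -> 2 * T <= (4 ^ n)%:R.
  by apply: big4; rewrite /n1 maxnC -maxnA leq_maxl.
have r4 : forall n, (n1 <= n)%N -> 2 * K * r <= (4 ^ n)%:R.
  by apply: big4; rewrite /n1 maxnC [maxn (Num.truncn _).+1 _]maxnC -maxnA leq_maxl.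
have [m Sm] := diverges n1; set S := \sum_(n1 <= n < m) a n in Sm.
have n1m : (n1 <= m)%N.
  by rewrite leqNgt; apply/negP => /ltnW mn; move: Sm; rewrite /S big_geq // ler10.
have [e eq] := ex_pow_inv_le m q0.
(* [nu l] is the number of the window containing grid index [l]; radius and weight depend on [l]
   through it. *)
pose nu l := (trunc_log 4 l - e)%N.
pose H' l := H (q (nu l)) (l%:R * h e).
pose w l := h e * a (nu l) / q (nu l).
pose l0 := (4 ^ (n1 + e))%N; pose l1 := (4 ^ (m + e))%N.
have l01 : (l0 <= l1)%N by rewrite leq_exp2l // leq_add2r.
have F'H i : Fs (i%:R * h e) (H' i) by apply: FsH.
have Tl0 : T <= l0%:R * h e.
  rewrite /l0 expnD natrM mulfK ?gt_eqF //; have := T4 _ (leqnn n1); lra.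
have FA0 : Fs (l0%:R * h e) A by apply: Fs_mono FA.
have mA := Fs_meas TT FA.
pose th := 2 * C1 + 6 * C * S.
have th0 : 0 < th by rewrite addr_gt0 ?mulr_gt0 // (lt_le_trans ltr01).
have up : \sum_(l0 <= l < l1) w l * Q (A `&` H' l) <= th * Q (A `&` hit H' l0 l1).
  apply: (@first_entrance_le _ _ _ P (fun i => Fs (i%:R * h e)) H') => //.
  - by move=> i D; apply: Fs_meas.
  - by move=> i D E; apply: FsI.
  - by move=> i D E; apply: FsD.
  - by move=> i D; apply: Fs_mono => //; rewrite ler_pM2r // ler_nat.
  - move=> j D /andP[jl0 jl1] FD _; have QD := fine_prob_ge0 P D.
    pose p := nu j.
    have j0 : (0 < j)%N by apply: leq_trans jl0; rewrite expn_gt0.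
    have /andP[pj1 pj2] := trunc_log_bounds (isT : (1 < 4)%N) j0.
    have ej : (e <= trunc_log 4 j)%N.
      by rewrite -(@trunc_expnK 4 e) // leq_trunc_log // (leq_trans _ jl0) // leq_exp2l // leq_addl.
    have pe : (p + e = trunc_log 4 j)%N by rewrite /p /nu subnK.
    have -> : \sum_(j <= l < l1) w l * Q (D `&` H' l) =
        \sum_(l0 <= l < l1) (if (j <= l)%N then w l * Q (D `&` H' l) else 0).
      rewrite [RHS](@big_cat_nat _ _ _ j) //=; last exact: ltnW.
      rewrite [X in _ = X + _]big_nat [X in _ = X + _]big1 ?add0r; last first.
        by move=> l /andP[_ lj]; rewrite leqNgt lj.
      by rewrite big_nat [RHS]big_nat; apply: eq_bigr => l /andP[-> _].
    rewrite sum_windows //.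
    (* After a first visit in window [p], earlier windows contribute nothing, windows [p] and [p.+1]
       are near, and all later ones are far; the indicators select the two near ones. *)
    apply: (@le_trans _ _ (\sum_(n1 <= k < m)
        (C1 * Q D * (k == p)%:R + C1 * Q D * (k == p.+1)%:R + 6 * C * Q D * a k))); last first.
      rewrite !big_split /= -!mulr_sumr -/S.
      have CQ : 0 <= C1 * Q D by rewrite mulr_ge0 // ltW.
      have -> : th * Q D = C1 * Q D * 1 + C1 * Q D * 1 + 6 * C * Q D * S by rewrite /th; ring.
      rewrite lerD2r.
      by apply: lerD; apply: ler_wpM2l => //; exact: sum_indicator_le1.
    apply: ler_sum_nat => n /andP[nn1 nm].
    have nns : (ns <= n)%N := leq_trans n1ns nn1.
    have CQ : 0 <= C1 * Q D by rewrite mulr_ge0 // ltW.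
    have aQ : 0 <= 6 * C * Q D * a n by rewrite !mulr_ge0 ?(ltW C0) ?(ltW (a0 nns)).
    have CQb (b : bool) : 0 <= C1 * Q D * b%:R by rewrite mulr_ge0.
    have -> : \sum_(4 ^ (n + e) <= l < 4 ^ (n.+1 + e))
          (if (j <= l)%N then w l * Q (D `&` H' l) else 0) =
        \sum_(4 ^ (n + e) <= l < 4 ^ (n.+1 + e))
          (if (j <= l)%N then h e * a n / q n * Q (D `&` H (q n) (l%:R * h e)) else 0).
      by apply: eq_big_nat => l /window_index nl; rewrite /w /H' /nu nl.
    have near : \sum_(4 ^ (n + e) <= l < 4 ^ (n.+1 + e))
          (if (j <= l)%N then h e * a n / q n * Q (D `&` H (q n) (l%:R * h e)) else 0) <= C1 * Q D.
      by apply: window_occupation_le => //; apply: eq.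
    have [np|pn|np] := ltngtP n p.
    + rewrite big_nat big1; last first.
        move=> l /andP[_ ll]; rewrite leqNgt (leq_trans ll) // (leq_trans _ pj1) //.
        by rewrite -pe leq_exp2l // leq_add2r.
      by apply: addr_ge0 => //; exact: addr_ge0.
    + have [_|np1] := eqVneq n p.+1.
        by rewrite /= mulr1n mulr1 mulr0n mulr0 add0r; exact: ler_wpDr.
      rewrite /= !mulr0n !mulr0 !add0r [leRHS]mulrAC; apply: le_trans (far_window_occupation_le (j := j) nns _ FD).
        apply: ler_sum_nat => l _; case: ifP => // _.
        by rewrite mulr_ge0 ?fine_prob_ge0 // divr_ge0 ?mulr_ge0 // ltW // a0.
      (* From [j < 4 ^ (p + e).+1] it follows that [4 * j] is below the start of window [p + 2]. *)
      rewrite (leq_trans (_ : _ <= 4 * 4 ^ (trunc_log 4 j).+1)%N) ?leq_mul2l ?(ltnW pj2) //.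
      rewrite -expnS leq_exp2l // -pe -!addSn leq_add2r.
      by rewrite ltn_neqAle eq_sym np1.
    + by rewrite /= mulr1n mulr1 -addrA; apply: ler_wpDr => //; exact: addr_ge0.
have lo : 3 / 4 * c * S * Q A <= \sum_(l0 <= l < l1) w l * Q (A `&` H' l).
  rewrite sum_windows // /S mulr_sumr mulr_suml.
  apply: ler_sum_nat => n /andP[nn1 nm]; have nns : (ns <= n)%N := leq_trans n1ns nn1.
  rewrite [leRHS](_ : _ = \sum_(4 ^ (n + e) <= l < 4 ^ (n.+1 + e))
          h e * a n / q n * Q (A `&` H (q n) (l%:R * h e))); last first.
    by apply: eq_big_nat => l /window_index nl; rewrite /w /H' /nu nl.
  exact: (window_occupation_ge e nns TT (T4 _ nn1) (r4 _ nn1) FA Ar).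
exists (l1%:R * h e), (hit H' l0 l1); split.
- by apply: (le_trans Tl0); rewrite ler_pM2r // ler_nat.
- have [F0 _ FU] := Fs_sigma (T0 e l1).
  rewrite /hit bigcup_mkcond; apply: FU => i; case: ifPn => [|_] //.
  rewrite inE /= => /andP[_ il]; apply: Fs_mono (F'H i) => //.
  by rewrite ler_pM2r // ler_nat ltnW.
- move=> x [l /= /andP[ll0 ll1] Hl]; exists (nu l), (l%:R * h e).
  have l_0 : (0 < l)%N by apply: leq_trans ll0; rewrite expn_gt0.
  have /andP[pl1 pl2] := trunc_log_bounds (isT : (1 < 4)%N) l_0.
  have nl : (n1 + e <= trunc_log 4 l)%N by rewrite -(@trunc_expnK 4 (n1 + e)) // leq_trunc_log.
  split => //; first by rewrite /nu leq_subRL ?(leq_trans (leq_addl n1 e)) // addnC (leq_trans _ nl) // leq_add2r.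
    rewrite ler_pdivlMr // -natrM -expnD ler_nat (leq_trans _ pl1) // leq_exp2l //.
    by rewrite /nu subnK // (leq_trans (leq_addl n1 e)).
  rewrite ler_pdivrMr // -natrM -expnD ler_nat ltnW // (leq_trans pl2) // leq_exp2l //.
  by rewrite /nu addSn subnK // (leq_trans (leq_addl n1 e)).
(* The divergence provides [S >= 1], which turns the constant part [2 * C1] into [2 * C1 * S]; then
   [S] cancels. *)
have key : 3 / 4 * c * S * Q A <= (2 * C1 + 6 * C) * S * Q (A `&` hit H' l0 l1).
  apply: (le_trans lo); apply: (le_trans up); rewrite ler_wpM2r ?fine_prob_ge0 // /th [leRHS]mulrDl lerD2r.
  by rewrite ler_peMr // mulr_ge0 // ltW.
have S0 : 0 < S by exact: lt_le_trans Sm.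
rewrite /hit_fraction -/C1 mulrAC ler_pdivrMr ?addr_gt0 ?mulr_gt0 //.
rewrite -(ler_pM2l S0); lra.
Qed.

(** * Recurrence by iterating the conditional hits *)

Hypothesis tight : forall t e : R, 0 <= t -> 0 < e ->
  exists2 r, 0 < r & Q (~` (H r t)) <= e.

(** Among the events containing [Z] that are known at some finite time, removing the next hit event
    lowers the probability by a fixed fraction, so their infimum is 0. This covers [Z] by null sets
    without asking it to be measurable. *)
Lemma recurrent_negligible (n0 : nat) (Z : set Omega) :
  (forall w n s, Z w -> (n0 <= n)%N -> (4 ^ n)%:R <= s -> s <= (4 ^ n.+1)%:R -> ~ H (q n) s w) ->
  P.-negligible Z.
Proof.
move=> Zw; pose d := hit_fraction; have d0 : 0 < d by exact: hit_fraction_gt0.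
(* Tightness places the process in some ball at time [T] outside an event of probability [e]; the
   hit estimate applies to the rest. *)
have step (T : R) A (e : R) : 0 <= T -> Fs T A -> Z `<=` A -> 0 < e ->
    exists T2 A2, [/\ 0 <= T2, Fs T2 A2, Z `<=` A2 & Q A2 <= Q A - d * (Q A - e)].
  move=> TT FA ZA e0; have [r r0 re] := tight TT e0.
  have mA := Fs_meas TT FA; have mr := Fs_meas TT (FsH TT r0).
  have FAr := FsI TT FA (FsH TT r0).
  have [T2 [Hit [TT2 FHit hitE dQ]]] := hit_windows n0 TT FAr (@subIsetr _ _ _).
  rewrite -/d in dQ.
  have T20 := le_trans TT TT2.
  have FA2 := Fs_mono TT TT2 FA; have mHit := Fs_meas T20 FHit.
  exists T2, (A `\` Hit); split => //; first exact: FsD.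
    move=> x Zx; split; first exact: ZA.
    by move=> /hitE [n [s [nn ns1 ns2 Hs]]]; exact: Zw Hs.
  have e1 := fine_prob_split P mA mHit; have e2 := fine_prob_split P mA mr.
  have mAr := measurableI _ _ mA mr.
  have l1 : Q (A `&` H r T `&` Hit) <= Q (A `&` Hit).
    by apply: le_fine_prob => //; [exact: measurableI|exact: measurableI|move=> x [[]]].
  have l2 : Q (A `\` H r T) <= e.
    by apply: le_trans re; apply: le_fine_prob; [exact: measurableD|exact: measurableC|move=> x []].
  have l3 : d * (Q A - e) <= d * Q (A `&` H r T) by rewrite ler_pM2l //; lra.
  lra.
pose S := [set x | exists T A, [/\ 0 <= T, Fs T A, Z `<=` A & x = Q A]].
have S0 : S (Q setT) by exists 0, setT; split => //; exact: FsT.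
have hS : has_inf S.
  split; first by exists (Q setT).
  by exists 0 => x [T [A [_ _ _ ->]]]; exact: fine_prob_ge0.
have inf0 : 0 <= inf S.
  by apply: lb_le_inf; [exists (Q setT)|move=> x [T [A [_ _ _ ->]]]; exact: fine_prob_ge0].
have infS : inf S = 0.
  apply/eqP; rewrite eq_le inf0 andbT leNgt; apply/negP => L0.
  have eta0 : 0 < d * inf S / 4 by rewrite divr_gt0 // mulr_gt0.
  have [x [T [A [TT FA ZA ->]]] xL] := inf_adherent eta0 hS.
  have L4 : 0 < inf S / 4 by rewrite divr_gt0.
  (* With [L = inf S], the new probability is below [L + d * L / 4 - d * (L - L / 4) = L - d * L /
     2], a contradiction. *)
  have [T2 [A2 [T20 FA2 ZA2 QA2]]] := step T A (inf S / 4) TT FA ZA L4.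
  have lo : inf S <= Q A2 by apply: ge_inf; [exact: hS.2|exists T2, A2].
  have lA : inf S <= Q A by apply: ge_inf; [exact: hS.2|exists T, A].
  have : d * (inf S - inf S / 4) <= d * (Q A - inf S / 4) by rewrite ler_pM2l //; lra.
  have : 0 < d * inf S by rewrite mulr_gt0.
  nra.
have cover k : exists A, [/\ measurable A, Z `<=` A & Q A < k.+1%:R^-1].
  have k0 : 0 < k.+1%:R^-1 :> R by rewrite invr_gt0.
  have [x [T [A [TT FA ZA ->]]]] := inf_adherent k0 hS.
  by rewrite infS add0r => xL; exists A; split => //; exact: Fs_meas FA.
have /choice [A hA] := cover.
exists (\bigcap_k A k); split.
- by apply: bigcap_measurable => [|k _]; [exists 0%N|have [] := hA k].
- have mI : measurable (\bigcap_k A k).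
    by apply: bigcap_measurable => [|k _]; [exists 0%N|have [] := hA k].
  apply/eqP; rewrite eq_le measure_ge0 andbT -[P _]fineK ?fin_num_measure // lee_fin.
  rewrite leNgt; apply/negP => p0.
  pose k := Num.truncn (Q (\bigcap_k A k))^-1.
  have [mAk _ Ak] := hA k.
  have : Q (\bigcap_k A k) <= Q (A k) by apply: le_fine_prob => // x; exact.
  move/le_lt_trans/(_ Ak); rewrite ltNge => /negP; apply.
  rewrite -[leRHS]invrK lef_pV2 ?posrE ?invr_gt0 //; exact: ltW (truncnS_gt _).
- by move=> x Zx k _; have [_ ZA _] := hA k; exact: ZA.
Qed.

End critical_process.

(** * Integral test *)

Definition window (R : realType) (n : nat) : set R := `[(4 ^ n)%:R, (4 ^ n.+1)%:R[%classic.
Arguments window : clear implicits.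

Section windows.
Variable R : realType.
Local Notation mu := (@lebesgue_measure R).
Local Notation I := (window R).

Let p4 k : 0 < (4 ^ k)%:R :> R. Proof. by rewrite ltr0n expn_gt0. Qed.

Lemma windowP (x : R) (n0 : nat) : (4 ^ n0)%:R <= x -> exists2 n, (n0 <= n)%N & I n x.
Proof.
move=> x0; have x_ge0 : 0 <= x by apply: le_trans x0; exact: ltW.
have kt : (4 ^ n0 <= Num.truncn x)%N by rewrite truncn_ge_nat.
have k0 : (0 < Num.truncn x)%N by apply: leq_trans kt; rewrite expn_gt0.
have /andP[h1 h2] := trunc_log_bounds (isT : (1 < 4)%N) k0.
exists (trunc_log 4 (Num.truncn x)); first exact: trunc_log_max.
rewrite /window /= in_itv /=; apply/andP; split.
  by apply: (@le_trans _ _ (Num.truncn x)%:R); rewrite ?ler_nat // truncn_le.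
by apply: (lt_le_trans (truncnS_gt x)); rewrite ler_nat.
Qed.

Lemma bigcup_window (n0 : nat) : \bigcup_k I (k + n0) = `[(4 ^ n0)%:R, +oo[%classic.
Proof.
apply/seteqP; split => x.
  move=> [k _]; rewrite /window /= !in_itv /= andbT => /andP[h _]; apply: le_trans h.
  by rewrite ler_nat leq_exp2l // leq_addl.
rewrite /= in_itv /= andbT => /windowP [n n0n In]; exists (n - n0)%N => //.
by rewrite subnK.
Qed.

Lemma trivIset_window (n0 : nat) : trivIset setT (fun k => I (k + n0)).
Proof.
move=> i j _ _ [x []]; rewrite /window /= !in_itv /= => /andP[i1 i2] /andP[j1 j2].
have := le_lt_trans i1 j2; have := le_lt_trans j1 i2; rewrite !ltr_nat !ltn_exp2l //.
by lia.
Qed.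

Lemma mu_window (n : nat) : mu (I n) = (3 * (4 ^ n)%:R)%:E.
Proof.
rewrite /window lebesgue_measure_itv /= lte_fin ltr_nat ltn_exp2l // ltnSn -EFinB.
by rewrite expnS natrM; congr (_%:E); ring.
Qed.

Variables (f : R -> R) (n0 : nat).
Hypothesis f_ge0 : forall t : R, (4 ^ n0)%:R <= t -> 0 <= f t.
Hypothesis f_ni : forall s t : R, (4 ^ n0)%:R <= s -> s <= t -> f t <= f s.

Lemma tail_measurable : measurable_fun (`[(4 ^ n0)%:R, +oo[%classic : set R) f.
Proof.
(* Freezing [f] before [4 ^ n0] makes it monotone on the whole line, hence measurable. *)
pose f' t := f (Num.max t (4 ^ n0)%:R).
have : measurable_fun (`[(4 ^ n0)%:R, +oo[%classic : set R) f'.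
  apply: nonincreasing_measurable => // s t st; apply: f_ni; first by rewrite le_max lexx orbT.
  by rewrite ge_max le_max st /= le_max lexx orbT.
apply: eq_measurable_fun => x; rewrite inE /= in_itv /= andbT => nx.
by rewrite /f' max_l.
Qed.

Let sub_tail n : (n0 <= n)%N -> I n `<=` `[(4 ^ n0)%:R, +oo[%classic.
Proof.
move=> nn x; rewrite /window /= !in_itv /= andbT => /andP[h _]; apply: le_trans h.
by rewrite ler_nat leq_exp2l.
Qed.

Let meas_window n : (n0 <= n)%N -> measurable_fun (I n) (EFin \o f).
Proof.
move=> nn; apply/measurable_EFinP; apply: measurable_funS tail_measurable => //.
exact: sub_tail.
Qed.

Lemma integral_window_ge n : (n0 <= n)%N ->
  ((f (4 ^ n.+1)%:R * (3 * (4 ^ n)%:R))%:E <= \int[mu]_(t in I n) (f t)%:E)%E.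
Proof.
move=> nn; rewrite EFinM -mu_window -integral_cst; last by rewrite /window.
apply: ge0_le_integral => //; first by rewrite /window.
- by move=> x _; rewrite lee_fin f_ge0 // ler_nat leq_exp2l // leqW.
- exact: meas_window.
- move=> x Ix; have := sub_tail nn Ix; rewrite /= in_itv /= andbT => x0.
  move: Ix; rewrite /window /= in_itv /= => /andP[_ /ltW h]; rewrite lee_fin; exact: f_ni.
Qed.

Lemma integral_window_le n : (n0 <= n)%N ->
  (\int[mu]_(t in I n) (f t)%:E <= (f (4 ^ n)%:R * (3 * (4 ^ n)%:R))%:E)%E.
Proof.
move=> nn; rewrite EFinM -mu_window -integral_cst; last by rewrite /window.
apply: ge0_le_integral => //; first by rewrite /window.
- move=> x Ix; have := sub_tail nn Ix; rewrite /= in_itv /= andbT => x0.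
  by rewrite lee_fin f_ge0.
- exact: meas_window.
- move=> x; rewrite /window /= in_itv /= => /andP[h _]; rewrite lee_fin; apply: f_ni => //.
  by rewrite ler_nat leq_exp2l.
Qed.

Lemma integral_tail_windows n : (n0 <= n)%N ->
  (\int[mu]_(t in `[(4 ^ n)%:R, +oo[) (f t)%:E =
   \sum_(k <oo) \int[mu]_(t in I (k + n)) (f t)%:E)%E.
Proof.
move=> nn; rewrite -bigcup_window ge0_integral_bigcup //.
- by move=> k; rewrite /window.
- rewrite bigcup_window; apply/measurable_EFinP; apply: measurable_funS tail_measurable => //.
  move=> x; rewrite /= !in_itv /= !andbT; apply: le_trans.
  by rewrite ler_nat leq_exp2l.
- move=> x; rewrite bigcup_window /= in_itv /= andbT => nx; rewrite lee_fin f_ge0 //.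
  by apply: le_trans nx; rewrite ler_nat leq_exp2l.
- exact: trivIset_window.
Qed.

End windows.

(** * Comparison of the tail integral with sums over the windows *)

Section integral_test.
Variables (R : realType) (g : R -> R) (n0 : nat).
Hypothesis g_gt0 : forall t : R, 0 < t -> 0 < g t.
Hypothesis g_ni : forall s t : R, 0 < s -> s <= t -> g t <= g s.
Hypothesis g_lt1 : g (4 ^ n0)%:R < 1.

Let p4 k : 0 < (4 ^ k)%:R :> R. Proof. by rewrite ltr0n expn_gt0. Qed.
Let f (t : R) := (t * `|ln (g t)|)^-1.

Let lng (t : R) : (4 ^ n0)%:R <= t -> ln (g t) < 0.
Proof.
move=> nt; have t0 := lt_le_trans (p4 n0) nt.
by apply: ln_lt0; rewrite g_gt0 //= (le_lt_trans (g_ni (p4 n0) nt)).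
Qed.

Let f_ge0 (t : R) : (4 ^ n0)%:R <= t -> 0 <= f t.
Proof. by move=> nt; rewrite invr_ge0 mulr_ge0 // ltW // (lt_le_trans (p4 n0)). Qed.

Let f_ni (s t : R) : (4 ^ n0)%:R <= s -> s <= t -> f t <= f s.
Proof.
move=> ns st; have nt := le_trans ns st.
have s0 := lt_le_trans (p4 n0) ns; have t0 := lt_le_trans s0 st.
rewrite /f !ltr0_norm ?lng // lef_pV2 ?posrE ?mulr_gt0 ?oppr_gt0 ?lng //.
by apply: ler_pM; rewrite ?oppr_ge0 ?(ltW (lng _)) ?(ltW s0) // lerN2 ler_ln ?posrE ?g_gt0 // g_ni.
Qed.

(** The integrand decreases once [g < 1], so its integral over a window is at least the right end
    value times [3 * 4 ^ n], that is 3/4 of the term. *)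
Lemma sum_tail_integral_lt_pinfty (n : nat) : (n0 <= n)%N ->
  (tail_integral g (4 ^ n)%:R < +oo)%E ->
  (\sum_(k <oo) (`|ln (g (4 ^ (k + n).+1)%:R)|^-1)%:E < +oo)%E.
Proof.
move=> nn; rewrite /tail_integral (integral_tail_windows f_ge0 f_ni nn) => h.
apply: (@le_lt_trans _ _ (\sum_(k <oo) (4 / 3)%:E * \int[lebesgue_measure]_(t in window R (k + n)) (f t)%:E)%E).
  apply: lee_nneseries => [k _|k _]; first by rewrite lee_fin invr_ge0.
  have nk : (n0 <= k + n)%N by rewrite (leq_trans nn) // leq_addl.
  have := integral_window_ge f_ge0 f_ni nk.
  have p43 : (0 <= (4 / 3 : R)%:E)%E by rewrite lee_fin divr_ge0.
  move=> hI; apply: le_trans (lee_wpmul2l p43 hI).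
  rewrite -EFinM lee_fin /f invfM expnS natrM.
  have -> : 4 / 3 * ((4%:R * (4 ^ (k + n))%:R)^-1 / `|ln (g (4%:R * (4 ^ (k + n))%:R))| * (3 * (4 ^ (k + n))%:R)) =
    `|ln (g (4%:R * (4 ^ (k + n))%:R))|^-1 :> R.
    have : 0 < `|ln (g (4%:R * (4 ^ (k + n))%:R))| :> R.
      rewrite normr_gt0 lt_eqF // lng // -natrM -expnS ler_nat leq_exp2l // leqW //.
    by move=> L0; field; rewrite !gt_eqF.
  by [].
have I0 k : (0 <= \int[lebesgue_measure]_(t in window R (k + n)) (f t)%:E)%E.
  apply: integral_ge0 => x; rewrite /window /= in_itv /= => /andP[nx _].
  by rewrite lee_fin f_ge0 // (le_trans _ nx) // ler_nat leq_exp2l // (leq_trans nn) // leq_addl.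
rewrite nneseriesZl // lte_mul_pinfty // ?lee_fin ?divr_ge0 //.
Qed.

(** The left end value bounds the integral over window [k.+1] by three times the term of index [k],
    whence the start at [4 ^ n.+1]; partial sums staying below 1 would keep the integral below 3. *)
Lemma tail_integral_pinfty_diverges (n : nat) : (n0 <= n)%N ->
  tail_integral g (4 ^ n.+1)%:R = +oo%E ->
  exists m, 1 <= \sum_(n <= k < m) `|ln (g (4 ^ k.+1)%:R)|^-1.
Proof.
move=> nn; rewrite /tail_integral (integral_tail_windows f_ge0 f_ni (leqW nn)) => h.
apply: contrapT => /forallNP no.
have I0 k : (0 <= \int[lebesgue_measure]_(t in window R (k + n.+1)) (f t)%:E)%E.
  apply: integral_ge0 => x; rewrite /window /= in_itv /= => /andP[nx _].
  by rewrite lee_fin f_ge0 // (le_trans _ nx) // ler_nat leq_exp2l // (leq_trans nn) // (leq_trans (leqnSn n)) // leq_addl.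
suff : (\sum_(k <oo) \int[lebesgue_measure]_(t in window R (k + n.+1)) (f t)%:E <= 3%:E)%E.
  by rewrite h.
apply: lime_le; first exact: is_cvg_nneseries.
apply: nearW => N /=.
apply: (@le_trans _ _ (\sum_(0 <= k < N) (3 * `|ln (g (4 ^ (k + n).+1)%:R)|^-1)%:E)%E).
  apply: lee_sum => k _; have nk : (n0 <= k + n.+1)%N by rewrite (leq_trans nn) // addnS leqW // leq_addl.
  apply: (le_trans (integral_window_le f_ge0 f_ni nk)); rewrite lee_fin /f invfM addnS.
  have -> // : (4 ^ (k + n).+1)%:R^-1 / `|ln (g (4 ^ (k + n).+1)%:R)| * (3 * (4 ^ (k + n).+1)%:R) =
    3 / `|ln (g (4 ^ (k + n).+1)%:R)| :> R.
  by rewrite mulrAC mulrCA mulVf ?gt_eqF // mulr1.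
rewrite sumEFin lee_fin -mulr_sumr -[leRHS]mulr1 ler_wpM2l //.
have := no (N + n)%N; rewrite -{1}[n]add0n big_addn addnK => /negP; rewrite -ltNge.
by move=> /ltW.
Qed.

End integral_test.

(** * Rate of escape *)

Section escape_rate.
Variables (R : realType) (d0 : measure_display) (M : measurableType d0).
Variables (dist : M -> M -> R) (D : R).
Hypothesis hmetric : is_metric dist.
Hypothesis hborel : borel_of dist.
Hypothesis D0 : 0 < D.
Variables (mu : {measure set M -> \bar R}).
Variables (dO : measure_display) (Omega : measurableType dO).
Variables (P : M -> probability Omega R) (X : R -> Omega -> M) (Fs : R -> set (set Omega)).
Hypothesis hX : hunt_process dist P X Fs.
Variables (p : R -> M -> M -> R) (a b : R).
Hypothesis hp : heat_kernel_of mu P X p.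
Hypothesis a0 : 0 < a.
Hypothesis b0 : 0 < b.
Hypothesis p_ge0 : forall (t : R) x y, 0 < t -> 0 <= p t x y.
Hypothesis p_le : forall (t : R) x y, 0 < t -> p t x y <= b / t.
Hypothesis p_le_off : forall (t : R) x y, 0 < t -> 0 < dist x y ->
  p t x y <= b * t / (dist x y `^ D) ^+ 2.
Hypothesis p_ge : forall (t : R) x y, 0 < t -> dist x y `^ D <= t -> a / t <= p t x y.
Variables (phiinv : R -> R) (l : R).
Hypothesis l0 : 0 < l.
Hypothesis lt_phiinv : forall t d : R, 0 < t -> 0 <= d -> d < phiinv t -> d `^ D < l * t.
Hypothesis gt_phiinv : forall t d : R, 0 < t -> 0 <= d -> d `^ D < l^-1 * t -> d < phiinv t.
Variable g : R -> R.
Hypothesis g_gt0 : forall t : R, 0 < t -> 0 < g t.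
Hypothesis g_ni : forall s t : R, 0 < s -> s <= t -> g t <= g s.
Hypothesis g_cvg0 : forall e : R, 0 < e -> exists T : R, forall t, T <= t -> g t < e.
Variable x0 : M.

Let event := [set w : Omega | exists T : R, forall s, T <= s -> phiinv (s * g s) <= dist (X s w) x0].
Let H (q t : R) := X t @^-1` (rball dist D x0 q).
Let C := b / a.
Let c := a * volume_const a b.
Let K : R := 2 `^ D.
Let K1 : 1 <= K.
Proof. by rewrite /K -[leLHS](powRr0 2); apply: ler_powR; [rewrite ler1n|exact: ltW]. Qed.
Let K0 : 0 < K. Proof. exact: lt_le_trans K1. Qed.
Let C0 : 0 < C. Proof. exact: divr_gt0. Qed.
Let c0 : 0 < c. Proof. by apply: mulr_gt0 => //; exact: volume_const_gt0. Qed.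
Let Cc0 (n : nat) : 0 <= n%:R * C / c.
Proof. by apply: divr_ge0; [apply: mulr_ge0 => //|]; exact: ltW. Qed.
Let p4 k : 0 < (4 ^ k)%:R :> R. Proof. by rewrite ltr0n expn_gt0. Qed.
Let g4 k : 0 < g (4 ^ k)%:R. Proof. exact: g_gt0. Qed.
Let dist_ge0 x y : 0 <= dist x y. Proof. by case: hmetric. Qed.
Let dist_sym x y : dist x y = dist y x. Proof. by case: hmetric. Qed.

Let Fs_meas (t : R) A : 0 <= t -> Fs t A -> measurable A.
Proof. by case: hX => -[h _ _ _] _ _ _ _ t0; apply: (h t t0).1. Qed.

Let Fs_sigma (t : R) : 0 <= t -> sigma_algebra setT (Fs t).
Proof. by case: hX => -[h _ _ _] _ _ _ _ t0; apply: (h t t0).2. Qed.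

Let Fs_mono (s t : R) : 0 <= s -> s <= t -> Fs s `<=` Fs t.
Proof. by case: hX => -[_ h _ _] _ _ _ _; exact: h. Qed.

Let FsH (q t : R) : 0 <= t -> 0 < q -> Fs t (H q t).
Proof.
by move=> t0 q0; case: hX => -[_ _ _ h] _ _ _ _; apply: h => //; exact: measurable_rball.
Qed.

Let H_le (t u q : R) A : 0 <= t -> 0 < u -> 0 < q -> Fs t A ->
  fine (P x0 (A `&` H q (t + u))) <= C * q / u * fine (P x0 A).
Proof. by move=> t0 u0 q0 FA; exact: (markov_rball_le hmetric hborel D0 hX hp). Qed.

Let H_ge (t u q r : R) A : 0 <= t -> 0 < u -> 0 < q ->
  K * q <= u -> K * r <= u -> Fs t A -> A `<=` H r t ->
  c * q / u * fine (P x0 A) <= fine (P x0 (A `&` H q (t + u))).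
Proof. by move=> t0 u0 q0 qu ru FA Ar; exact: (markov_rball_ge hmetric hborel D0 hX hp a0 b0 p_ge0 p_le p_le_off p_ge t0 u0 q0 qu ru FA Ar). Qed.

Let tight (t e : R) : 0 <= t -> 0 < e -> exists2 r, 0 < r & fine (P x0 (~` (H r t))) <= e.
Proof. by move=> t0 e0; exact: (rball_tight hmetric hborel D0 hX x0). Qed.

Lemma H_right_open (q s : R) w : 0 <= s -> 0 < q -> H q s w ->
  exists2 d : R, 0 < d & forall s', s <= s' < s + d -> H q s' w.
Proof.
move=> s0 q0; rewrite /H /= rball_dball // => Hs.
have [e e0 eB] := d_open_dball hmetric Hs.
case: hX => _ _ [rc _] _ _; have [d d_gt0 hd] := rc w s s0 e e0.
exists d => // s' /hd ds; apply: eB; rewrite /dball /= dist_sym //.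
Qed.

Lemma g_small (e : R) : 0 < e -> exists N, forall n, (N <= n)%N -> g (4 ^ n)%:R < e.
Proof.
move=> e0; have [T hT] := g_cvg0 e0; exists (Num.truncn T).+1 => n Nn.
apply: hT; apply: ltW; apply: (lt_le_trans (truncnS_gt T)).
by rewrite ler_nat (leq_trans Nn) // ltnW // ltn_expl.
Qed.

Lemma tail_integrand_measurable (T : R) : 0 < T ->
  measurable_fun (`[T, +oo[%classic : set R) (fun t => (t * `|ln (g t)|)^-1).
Proof.
move=> T0; pose g' t := g (Num.max t T).
have mg' : measurable_fun (`[T, +oo[%classic : set R) g'.
  apply: nonincreasing_measurable => // s t st; apply: g_ni.
    by rewrite lt_max T0 orbT.
  by rewrite ge_max le_max st /= le_max lexx orbT.
(* The power [-1] agrees with the inverse on nonnegative reals, at 0 as well, where both are 0; this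
   covers the points with [g t = 1]. *)
pose f' (t : R) := (t * `|ln (g' t)|) `^ (-1).
have : measurable_fun (`[T, +oo[%classic : set R) f'.
  apply: (measurableT_comp (@measurable_powR R (-1))).
  apply: measurable_funM => //; apply: measurableT_comp => //.
  by apply: measurableT_comp => //; exact: measurable_ln.
apply: eq_measurable_fun => x; rewrite inE /= in_itv /= andbT => Tx.
rewrite /f' /g' max_l // powR_inv1 // mulr_ge0 //.
by rewrite (le_trans _ Tx) // ltW.
Qed.

Lemma escape_of_finite_integral (T : R) : 1 <= T -> (tail_integral g T < +oo)%E ->
  (P x0).-negligible (~` event).
Proof.
move=> T1 hT; have T0 : 0 < T by exact: lt_le_trans T1.
pose k8 := 8 * K * l; have k80 : 0 < k8 by rewrite !mulr_gt0.
(* Below this threshold [1 / g] exceeds 1, [k8] and [k8 ^ 2]; the last makes [ln (1 / (g * k8))] at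
   least half of [ln (1 / g)]. *)
have e0 : 0 < ((1 + k8) ^+ 2)^-1 by rewrite invr_gt0 exprn_gt0 // addr_gt0.
have [N hN] := g_small e0.
pose n0 := maxn N (Num.truncn T).+1.
have Tn0 : T <= (4 ^ n0)%:R.
  apply: ltW; apply: (lt_le_trans (truncnS_gt T)).
  by rewrite ler_nat (leq_trans (leq_maxr N _)) // ltnW // ltn_expl.
have k81 : 1 < (1 + k8) ^+ 2 by rewrite exprn_egt1 // ltrDl.
have gn n : (n0 <= n)%N -> (1 + k8) ^+ 2 < (g (4 ^ n)%:R)^-1.
  move=> nn; rewrite -[ltLHS]invrK ltf_pV2 ?posrE ?(g4 n) ?e0 //.
  by apply: hN; rewrite (leq_trans _ nn) // leq_maxl.
have g1 : g (4 ^ n0)%:R < 1.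
  by rewrite -[ltLHS]invrK invf_lt1 ?invr_gt0 // (lt_trans k81) // gn.
have tail0 : (tail_integral g (4 ^ n0)%:R < +oo)%E.
  apply: le_lt_trans hT; rewrite /tail_integral; apply: ge0_subset_integral => //.
  - by apply/measurable_EFinP; apply: tail_integrand_measurable.
  - move=> x; rewrite /= in_itv /= andbT => Tx; rewrite lee_fin invr_ge0 mulr_ge0 //.
    by rewrite (le_trans _ Tx) // ltW.
  - by move=> x; rewrite /= !in_itv /= !andbT; exact: le_trans.
have sum_fin := sum_tail_integral_lt_pinfty g_gt0 g_ni g1 (leqnn n0) tail0.
(* An outer radius: for [s] in window [n], [dist < phiinv (s * g s)] forces rho below
   [l * s * g s <= q n]. *)
pose q n := l * (4 ^ n.+1)%:R * g (4 ^ n)%:R.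
have q0 n : 0 < q n by rewrite !mulr_gt0.
pose F k := window_hit H (4 ^ (k + n0).+1)%:R (q (k + n0).+1).
have mF k : measurable (F k) by exact: (measurable_window_hit Fs_meas FsH).
have PF k : (P x0 (F k) <= (8 * C / c)%:E * (`|ln (g (4 ^ (k + n0).+1)%:R)|^-1)%:E)%E.
  set n := (k + n0).+1; have nn : (n0 <= n)%N by rewrite /n leqW // leq_addl.
  have gk := gn n nn.
  have e1 : (4 ^ n)%:R / (2 * K * q n) = (g (4 ^ n)%:R)^-1 / k8.
    rewrite /q /k8 expnS natrM; field; by rewrite !gt_eqF.
  have gk8 : k8 < (g (4 ^ n)%:R)^-1.
    by apply: lt_trans gk; rewrite expr2; have := mulr_gt0 k80 k80; nra.
  have K2 : 2 * K * q n < (4 ^ n)%:R.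
    have : 1 < (g (4 ^ n)%:R)^-1 / k8 by rewrite ltr_pdivlMr // mul1r.
    by rewrite -e1 ltr_pdivlMr ?mul1r // !mulr_gt0.
  apply: (le_trans (window_hit_le C0 c0 K1 Fs_meas Fs_sigma Fs_mono FsH H_le H_ge _ (q0 n) K2)) => //.
  rewrite -EFinM lee_fin e1.
  have lng : ln (g (4 ^ n)%:R) < 0.
    by apply: ln_lt0; rewrite g4 /= (le_lt_trans _ g1) // g_ni // ler_nat leq_exp2l.
  rewrite ltr0_norm // -lnV ?posrE //.
  set y := (g _)^-1 in gk gk8 *; have y0 : 0 < y by rewrite /y invr_gt0.
  have lny : 0 < ln y by rewrite /y lnV ?posrE // oppr_gt0.
  have lnk : 2 * ln k8 <= ln y.
    have -> : 2 * ln k8 = ln (k8 ^+ 2) by rewrite lnXn // mulr_natl.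
    rewrite ler_ln ?posrE ?exprn_gt0 // ltW // (le_lt_trans _ gk) //.
    by rewrite ler_pXn2r ?nnegrE ?addr_ge0 ?(ltW k80) // lerDr.
  have lnd : ln y / 2 <= ln (y / k8) by rewrite ln_div ?posrE //; lra.
  have lnd0 : 0 < ln y / 2 by rewrite divr_gt0.
  apply: (@le_trans _ _ (4 * C / c / (ln y / 2))).
    apply: ler_wpM2l; first exact: Cc0.
    by rewrite lef_pV2 ?posrE // (lt_le_trans lnd0).
  have -> // : 4 * C / c / (ln y / 2) = 8 * C / c / ln y.
  by field; rewrite !gt_eqF.
(* Borel-Cantelli: a path that fails to escape returns at arbitrarily late times, hence lies in
   infinitely many [F k]. *)
exists (lim_sup_set F); split.
- apply: bigcap_measurable => [|n _]; first by exists 0%N.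
  by apply: bigcup_measurable => k _.
- apply: lim_sup_set_cvg0 => //.
  apply: (@le_lt_trans _ _ (\sum_(k <oo) (8 * C / c)%:E * (`|ln (g (4 ^ (k + n0).+1)%:R)|^-1)%:E)%E).
    by apply: lee_nneseries => // k _; exact: PF.
  rewrite nneseriesZl; last by move=> k _; rewrite lee_fin invr_ge0.
  by rewrite lte_mul_pinfty // lee_fin; exact: Cc0.
- move=> w /= /forallNP nw n _.
  have /existsNP [s /not_implyP [ns]] := nw (4 ^ (n + n0).+1)%:R.
  move=> /negP; rewrite -ltNge => ds.
  have [m nm] := windowP ns; rewrite /window /= in_itv /= => /andP[ms sm].
  have s0 : 0 < s by apply: lt_le_trans ms.
  have sg0 : 0 < s * g s by rewrite mulr_gt0 // g_gt0.
  have Hs : H (q m) s w.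
    rewrite /H /= /rball /= dist_sym; apply: (lt_le_trans (lt_phiinv sg0 (dist_ge0 _ _) ds)).
    rewrite /q -mulrA ler_pM2l //; apply: ler_pM; rewrite ?(ltW s0) ?(ltW (g_gt0 s0)) ?(ltW sm) //.
    exact: g_ni.
  have [d d_gt0 hd] := H_right_open (ltW s0) (q0 m) Hs.
  have mk : (m - n0.+1 + n0).+1 = m by rewrite -addnS subnK // (leq_trans _ nm) // ltnS leq_addl.
  exists (m - n0.+1)%N => /=.
    by rewrite -(addnK n0.+1 n) leq_sub2r // addnS.
  rewrite /F mk; apply: (mem_window_hit (s := s) (d := d)) => //.
  by rewrite ms /= -natrM -expnS.
Qed.

Lemma recurrence_of_infinite_integral :
  (forall T : R, 1 <= T -> tail_integral g T = +oo%E) -> (P x0).-negligible event.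
Proof.
move=> hT.
(* The first bound gives [|ln g| >= 1], so [an n <= 1]; the second gives [2 * K * q n <= 4 ^ n]. *)
pose e := Num.min (expR (-1)) (l / (2 * K)).
have e0 : 0 < e by rewrite lt_min expR_gt0 divr_gt0 ?mulr_gt0.
have [ns hns] := g_small e0.
have gs n : (ns <= n)%N -> g (4 ^ n)%:R < expR (-1) /\ g (4 ^ n)%:R < l / (2 * K).
  by move=> /hns; rewrite lt_min => /andP.
(* An inner radius: for [s] in window [n], rho below [q n <= l^-1 * s * g s] forces
   [dist < phiinv (s * g s)]. *)
pose q n := l^-1 * (4 ^ n)%:R * g (4 ^ n.+1)%:R.
pose an n := `|ln (g (4 ^ n.+1)%:R)|^-1.
pose B := 1 + `|ln (4 * l)|.
have q0 n : 0 < q n by rewrite !mulr_gt0 ?invr_gt0.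
have ln1 n : (ns <= n)%N -> 1 < - ln (g (4 ^ n)%:R).
  move=> /gs[h _]; rewrite ltrNr -[ltRHS]expRK ltr_ln // posrE //; exact: expR_gt0.
have anE n : (ns <= n)%N -> an n = (- ln (g (4 ^ n.+1)%:R))^-1.
  move=> nn; rewrite /an ltr0_norm // -oppr_gt0; apply: lt_trans (ln1 n.+1 (leqW nn)); exact: ltr01.
have an0 n : (ns <= n)%N -> 0 < an n.
  by move=> nn; rewrite anE // invr_gt0 (lt_trans ltr01) // ln1 // leqW.
have an1 n : (ns <= n)%N -> an n <= 1.
  by move=> nn; rewrite anE // invf_le1 ?(lt_trans ltr01) ?ltW ?ln1 // leqW.
have B0 : 0 <= B by rewrite addr_ge0.
have Kq n : (ns <= n)%N -> 2 * K * q n <= (4 ^ n)%:R.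
  move=> nn; have [_ h] := gs n.+1 (leqW nn).
  have -> : 2 * K * q n = (4 ^ n)%:R * (g (4 ^ n.+1)%:R * (2 * K) / l) by rewrite /q; ring.
  by rewrite ler_piMr ?ltW // ltr_pdivrMr // mul1r -ltr_pdivlMr ?mulr_gt0.
have lnq n : (ns <= n)%N -> ln ((4 ^ n.+1)%:R / q n) <= B / an n.
  move=> nn; have h1 := ln1 n.+1 (leqW nn).
  have -> : (4 ^ n.+1)%:R / q n = 4 * l / g (4 ^ n.+1)%:R.
    by rewrite /q {1}expnS natrM; field; rewrite !gt_eqF.
  have -> : ln (4 * l / g (4 ^ n.+1)%:R) = ln (4 * l) - ln (g (4 ^ n.+1)%:R).
    by rewrite ln_div ?posrE ?mulr_gt0.
  rewrite anE // invrK /B [leRHS]mulrDl mul1r.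
  have h2 : `|ln (4 * l)| <= `|ln (4 * l)| * - ln (g (4 ^ n.+1)%:R) by rewrite ler_peMr // ltW.
  have h3 := ler_norm (ln (4 * l)); lra.
have div n : exists m, 1 <= \sum_(n <= k < m) an k.
  have g1 : g (4 ^ ns)%:R < 1.
    by have [h _] := gs ns (leqnn ns); apply: (lt_trans h); rewrite expR_lt1 oppr_lt0.
  (* The integral test starts at [ns] or later; the terms between [n] and [n'] are nonnegative and
     only help. *)
  pose n' := maxn ns n.
  have hT' : tail_integral g (4 ^ n'.+1)%:R = +oo%E by apply: hT; rewrite ler1n expn_gt0.
  have [m hm] := tail_integral_pinfty_diverges g_gt0 g_ni g1 (leq_maxl ns n) hT'.
  exists m; apply: (le_trans hm).
  have [nm|mn] := leqP n' m; last first.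
    by rewrite (big_geq (ltnW mn)); apply: sumr_ge0 => i _; rewrite invr_ge0.
  rewrite [leRHS](@big_cat_nat _ _ _ n') ?leq_maxr //= ler_wpDl // sumr_ge0 // => i _.
  by rewrite invr_ge0.
(* Eventual escape is a countable union over the integer time after which the path stays outside;
   each piece is null. *)
pose Z k := [set w : Omega | forall s : R, k%:R <= s -> phiinv (s * g s) <= dist (X s w) x0].
apply: (@negligibleS _ _ _ _ (\bigcup_k Z k)).
  move=> w [T hw]; exists (Num.truncn T).+1 => // s Ts; apply: hw.
  by apply: le_trans Ts; exact: ltW (truncnS_gt T).
apply: negligible_bigcup => k.
apply: (recurrent_negligible C0 c0 K1 Fs_meas Fs_sigma Fs_mono FsH H_le H_ge q0 an0 an1 B0 Kq lnq div
  tight (n0 := k)).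
move=> w n s Zw kn ns1 ns2; rewrite /H /= /rball /= => ds.
have s0 : 0 < s by apply: lt_le_trans ns1.
have sg0 : 0 < s * g s by rewrite mulr_gt0 // g_gt0.
have : k%:R <= s by apply: le_trans ns1; rewrite ler_nat (leq_trans kn) // ltnW // ltn_expl.
move=> /Zw; rewrite leNgt => /negP; apply; apply: gt_phiinv => //.
rewrite dist_sym; apply: (lt_le_trans ds); rewrite /q -mulrA ler_pM2l ?invr_gt0 //.
by apply: ler_pM; [exact: ltW|exact: ltW|exact: ns1|exact: g_ni].
Qed.

End escape_rate.

(** Probability 1 or 0 is expressed by negligibility of an event, which is meaningful before its
    measurability is known. The integral condition is put on tails: a finite [t] with [g t = 1] may
    make the integral from 1 diverge, whereas escape depends on [g] near infinity alone. *)
Theorem theorem4p18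
  (R : realType) (d0 : measure_display) (M : measurableType d0) (dist : M -> M -> R)
  (hmetric : is_metric dist) (hlcs : locally_compact_sep dist)
  (hborel : borel_of dist)
  (mu : {measure set M -> \bar R}) (hmu : radon_full_support dist mu)
  (F : set (M -> R)) (E : (M -> R) -> (M -> R) -> R)
  (hDF : dirichlet_form mu F E) (hreg : regular_form dist mu F E)
  (dO : measure_display) (Omega : measurableType dO)
  (P : M -> probability Omega R) (X : R -> Omega -> M) (Fs : R -> set (set Omega))
  (hX : hunt_process dist P X Fs) (hassoc : associated mu F E P X)
  (V phi phiinv : R -> R) (c1 c2 c3 c4 d1 d2 d3 d4 : R)
  (hcpos : [/\ 0 < c1, 0 < c2, 0 < c3 & 0 < c4])
  (hdpos : [/\ 0 < d1, 0 < d2, 0 < d3 & 0 < d4])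
  (hV : scaling V c1 c2 d1 d2) (hphi : scaling phi c3 c4 d3 d4)
  (hphiinv : forall t, 0 < t -> 0 < phiinv t /\ phi (phiinv t) = t)
  (hphiinv' : forall r, 0 < r -> phiinv (phi r) = r)
  (p : R -> M -> M -> R) (hp : heat_kernel_of mu P X p)
  (c : R) (hc : 1 <= c)
  (hHK : forall t x y, 0 < t ->
     c^-1 * hk_profile dist V phi phiinv t x y <= p t x y /\
     p t x y <= c * hk_profile dist V phi phiinv t x y)
  (hd : [/\ d1 = d2, d2 = d3 & d3 = d4])
  (g : R -> R)
  (hgpos : forall t, 0 < t -> 0 < g t)
  (hgdec : forall s t, 0 < s -> s <= t -> g t <= g s)
  (hg0 : forall e : R, 0 < e -> exists T : R, forall t, T <= t -> g t < e) :
  let varphi := fun t => phiinv (t * g t) in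
  let event := fun x0 : M =>
    [set w : Omega | exists T : R, forall s, T <= s -> varphi s <= dist (X s w) x0] in
  ((exists T : R, 1 <= T /\ (tail_integral g T < +oo)%E) ->
     forall x0, (P x0).-negligible (~` event x0))
  /\
  ((forall T : R, 1 <= T -> tail_integral g T = +oo%E) ->
     forall x0, (P x0).-negligible (event x0)).
Proof.
have [e12 e23 e34] := hd; have [c10 c20 c30 c40] := hcpos; have [D0 _ _ _] := hdpos.
rewrite -e34 -e23 -e12 in hphi; rewrite -e12 in hV.
have [k k0 hVk] := scaling_powR c10 c20 hV.
have [l l0 hphil] := scaling_powR c30 c40 hphi.
have dist_ge0 x y : 0 <= dist x y by case: hmetric.
have c0 : 0 < c by exact: lt_le_trans hc.
have kl : 0 < k * l by rewrite mulr_gt0.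
(* [a] and [b] combine the heat kernel constant [c] with the power-law constants [k] of [V] and [l]
   of [phi]. *)
pose a := c^-1 * (k * l)^-1; pose b := c * (k * l).
have a0 : 0 < a by rewrite mulr_gt0 ?invr_gt0.
have b0 : 0 < b by rewrite mulr_gt0.
have p_ge0 (t : R) x y : 0 < t -> 0 <= p t x y.
  move=> t0; have [h _] := hHK t x y t0; apply: le_trans h.
  apply: mulr_ge0; first by rewrite invr_ge0 ltW.
  exact: (hk_profile_ge0 dist_ge0 k0 l0 hVk hphil hphiinv).
have p_le (t : R) x y : 0 < t -> p t x y <= b / t.
  move=> t0; have [_ h] := hHK t x y t0; apply: (le_trans h).
  rewrite /b -mulrA ler_pM2l //.
  exact: (hk_profile_le_inv _ k0 l0 hVk hphil hphiinv).
have p_le_off (t : R) x y : 0 < t -> 0 < dist x y -> p t x y <= b * t / (dist x y `^ d1) ^+ 2.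
  move=> t0 r0; have [_ h] := hHK t x y t0; apply: (le_trans h).
  have -> : b * t / (dist x y `^ d1) ^+ 2 = c * (k * l * t / (dist x y `^ d1) ^+ 2).
    by rewrite /b; ring.
  by rewrite ler_pM2l //; exact: (hk_profile_le_off _ k0 l0 hVk hphil).
have p_ge (t : R) x y : 0 < t -> dist x y `^ d1 <= t -> a / t <= p t x y.
  move=> t0 r0; have [h _] := hHK t x y t0; apply: le_trans h.
  by rewrite /a -mulrA ler_pM2l ?invr_gt0 //; exact: (hk_profile_ge dist_ge0 k0 l0 hVk hphil hphiinv t0 r0).
have lt_phi := lt_phiinv_powR D0 l0 hphil hphiinv.
have gt_phi := powR_lt_phiinv D0 l0 hphil hphiinv.
move=> varphi event; split=> [[T [T1 hT]] x0|hT x0].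
  exact: (escape_of_finite_integral hmetric hborel D0 hX hp a0 b0 p_ge0 p_le p_le_off p_ge
    l0 lt_phi hgpos hgdec hg0 x0 T1 hT).
exact: (recurrence_of_infinite_integral hmetric hborel D0 hX hp a0 b0 p_ge0 p_le p_le_off p_ge
  l0 gt_phi hgpos hgdec hg0 x0 hT).
Qed.
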